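(* Let $n\ge 1$ be an integer, $p,q\in[1,\infty)$ and $\lambda,\sigma,\alpha,\beta\in(0,\infty)$. Assume that $$\left(p>1\text{ and }0<\alpha<\tfrac{n+2}{2p}\right)\ \text{ or }\ \left(p=1\text{ and }0<\alpha\le\tfrac{n+2}{2p}\right),$$ $$\left(q>1\text{ and }0<\beta<\tfrac{n+2}{2q}\right)\ \text{ or }\ \left(q=1\text{ and }0<\beta\le\tfrac{n+2}{2q}\right),$$ that $(n+2-2p\alpha)q^2\sigma\le(n+2-2q\beta)p^2\lambda$, that $2p\alpha<n+2$, and that $$\sigma>\mu(\lambda):=\frac{2p\beta}{n+2-2p\alpha}+\frac{n+2}{(n+2-2p\alpha)\lambda}.$$ Let $$r_0=\frac{(n+2)(\lambda\sigma-1)}{2(\beta+\alpha\sigma)\lambda}\quad\text{and}\quad s_0=\frac{(n+2)(\lambda\sigma-1)}{2(\alpha+\beta\lambda)\sigma}.$$ Then $r_0>p$, $s_0>q$, and for each $r\in[r_0,\infty]$ and $s\in[s_0,\infty]$ there exist solutions $u\in Y^p_\alpha$ and $v\in Y^q_\beta$ of the initial value problem $$0\le(\partial_t-\Delta)^\alpha u\le v^\lambda,\qquad 0\le(\partial_t-\Delta)^\beta v\le u^\sigma\qquad\text{in }\mathbb{R}^n\times\mathbb{R},$$ $$u=v=0\quad\text{in }\mathbb{R}^n\times(-\infty,0),$$ and a sequence $\{t_j\}\subset(1,\infty)$ such that $\lim_{j\to\infty}t_j=\infty$ and $$\|v^\lambda\|_{L^r(R_j)}=\|(\partial_t-\Delta)^\alpha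 u\|_{L^r(R_j)}=\infty,\qquad\|u^\sigma\|_{L^s(R_j)}=\|(\partial_t-\Delta)^\beta v\|_{L^s(R_j)}=\infty$$ for $j=1,2,\dots$, where $$R_j=\{(x,t)\in\mathbb{R}^n\times\mathbb{R}:|x|<\sqrt{t_j}\text{ and }t_j<t<2t_j\}.$$
   Context: For $p\ge1$, $X^p:=\bigcap_{T\in\mathbb{R}}L^p(\mathbb{R}^n\times(-\infty,T))$, i.e. the set of measurable $f:\mathbb{R}^n\times\mathbb{R}\to\mathbb{R}$ with $\|f\|_{L^p(\mathbb{R}^n\times(-\infty,T))}<\infty$ for all $T\in\mathbb{R}$ (functions equal a.e. are identified). For $\alpha>0$ the fractional heat kernel is $$\Phi_\alpha(x,t):=\frac{t^{\alpha-1}}{\Gamma(\alpha)}\frac{1}{(4\pi t)^{n/2}}e^{-|x|^2/(4t)}\chi_{(0,\infty)}(t),$$ and $$J_\alpha f(x,t):=\iint_{\mathbb{R}^n\times(-\infty,t)}\Phi_\alpha(x-\xi,t-\tau)f(\xi,\tau)\,d\xi\,d\tau .$$ Set $Y^p_\alpha:=J_\alpha(X^p)$. When ($p>1$ and $0<\alpha<\frac{n+2}{2p}$) or ($p=1$ and $0<\alpha\le\frac{n+2}{2p}$), it is known that $J_\alpha f\in L^p_{\rm loc}(\mathbb{R}^n\times\mathbb{R})$ for $f\in X^p$ and that $J_\alpha:X^p\to Y^p_\alpha$ is one-to-one and onto; the fully fractional heat operator $(\partial_t-\Delta)^\alpha:Y^p_\alpha\to X^p$ is defined as the inverse of $J_\alpha:X^p\to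 Y^p_\alpha$. Likewise $(\partial_t-\Delta)^\beta:Y^q_\beta\to X^q$ is the inverse of $J_\beta:X^q\to Y^q_\beta$. *)

(* Defs.v *)
From HB Require Import structures.
From mathcomp Require Import all_boot all_order all_algebra.
From mathcomp Require Import all_classical all_reals all_analysis.

Set Implicit Arguments.
Unset Strict Implicit.
Unset Printing Implicit Defensive.
Import Order.TTheory GRing.Theory Num.Theory.
Import numFieldNormedType.Exports.

Local Open Scope classical_set_scope.
Local Open Scope ring_scope.

(* [measurableTypeR R] is R with the measurable structure on which the library
   defines [lebesgue_measure].  Tuples and pairs carry the product
   sigma-algebra, so measurable means Borel measurable; this loses nothing,
   since every Lebesgue measurable function has a Borel representative and
   functions are only considered up to equality almost everywhere. *)
Notation Rspace R n := (n.-tuple (measurableTypeR R)).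
Notation Rspacetime R n := (Rspace R n * measurableTypeR R)%type.

Section lebesgue_tuple.
Variable R : realType.

Definition cons_pair n (z : Rspacetime R n) : Rspace R n.+1 :=
  [the n.+1.-tuple _ of z.2 :: z.1].

Definition uncons_pair n (x : Rspace R n.+1) : Rspacetime R n :=
  ([tuple of behead x], thead x).

Lemma cons_pairK n : cancel (@cons_pair n) (@uncons_pair n).
Proof. by move=> [x t]; congr (_, _); apply/val_inj. Qed.

Lemma measurable_cons_pair n : measurable_fun setT (@cons_pair n).
Proof.
apply: measurable_cons; first exact: measurable_snd.
exact: measurable_fst.
Qed.

Lemma measurable_uncons_pair n : measurable_fun setT (@uncons_pair n).
Proof.
apply/measurable_fun_pair; first exact: measurable_behead.
exact: measurable_tnth.
Qed.

Section times_lebesgue.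
Variables (n : nat) (m : {sigma_finite_measure set (Rspace R n) -> \bar R}).

(* On products, the library registers the sigma-finite structure only for
   factors that are subprobabilities. *)
Definition times_lebesgue : set (Rspacetime R n) -> \bar R :=
  (m \x @lebesgue_measure R)%E.

HB.instance Definition _ := Measure.on times_lebesgue.

Let times_lebesgue_sigma_finite : sigma_finite setT times_lebesgue.
Proof.
have /sigma_finiteP[F [TF ndF Foo]] := sigma_finiteT m.
have /sigma_finiteP[G [TG ndG Goo]] := sigma_finiteT (@lebesgue_measure R).
exists (fun k => F k `*` G k).
  rewrite -setXTT TF TG predeqE => -[x y]; split.
    move=> [/= [i _ Fx] [k _ Gky]]; exists (maxn i k) => //; split.
    - by move: x Fx; exact/subsetPset/ndF/leq_maxl.
    - by move: y Gky; exact/subsetPset/ndG/leq_maxr.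
  by move=> [i _ []/= ? ?]; split; exists i.
move=> k; have [mF Fk] := Foo k; have [mG Gk] := Goo k.
split; first exact: measurableX.
by rewrite /times_lebesgue product_measure1E// lte_mul_pinfty// ge0_fin_numE.
Qed.

HB.instance Definition _ := Measure_isSigmaFinite.Build _ _ _ times_lebesgue
  times_lebesgue_sigma_finite.

Definition cons_measure : set (Rspace R n.+1) -> \bar R :=
  pushforward times_lebesgue (@cons_pair n).

Let mcons := @measurable_cons_pair n.

Let cons_measure0 : cons_measure set0 = 0%E.
Proof. exact: measure0. Qed.

Let cons_measure_ge0 A : (0 <= cons_measure A)%E.
Proof. exact: measure_ge0. Qed.

Let cons_measure_sigma_additive : semi_sigma_additive cons_measure.
Proof. exact: measure_semi_sigma_additive. Qed.

HB.instance Definition _ := isMeasure.Build _ _ _ cons_measure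
  cons_measure0 cons_measure_ge0 cons_measure_sigma_additive.

Let cons_measure_sigma_finite : sigma_finite setT cons_measure.
Proof.
have [F FT Foo] := sigma_finiteT times_lebesgue.
exists (fun k => @uncons_pair n @^-1` F k).
  by rewrite -preimage_bigcup -FT.
move=> k; have [mF Fk] := Foo k; split.
  by rewrite -[X in measurable X]setTI; exact: measurable_uncons_pair.
rewrite /cons_measure /pushforward -comp_preimage.
by rewrite (_ : _ \o _ = id)// funeqE => z /=; rewrite cons_pairK.
Qed.

HB.instance Definition _ := Measure_isSigmaFinite.Build _ _ _ cons_measure
  cons_measure_sigma_finite.

End times_lebesgue.

(* Lebesgue measure on R^n as an iterated product of the one-dimensional one;
   R^0 is a single point, of mass 1. *)
Fixpoint lebesgue_tuple n : {sigma_finite_measure set (Rspace R n) -> \bar R} :=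
  match n with
  | 0 => \d_ ([tuple] : Rspace R 0)
  | k.+1 => cons_measure (lebesgue_tuple k)
  end.

Lemma lebesgue_tuple_box n (A : 'I_n -> set (measurableTypeR R)) :
  (forall i, measurable (A i)) ->
  lebesgue_tuple n [set x | forall i, A i (tnth x i)] =
  (\prod_(i < n) lebesgue_measure (A i))%E.
Proof.
elim: n A => [|n IH] A mA.
  rewrite big_ord0 [X in lebesgue_tuple _ X](_ : _ = setT) /= ?diracT//.
  by apply/seteqP; split => // x _ [].
rewrite big_ord_recl /= /cons_measure /pushforward.
rewrite (_ : _ @^-1` _ = [set x | forall i, A (lift ord0 i) (tnth x i)] `*`
    A ord0); last first.
  apply/seteqP; split => -[x t] /= => [h|[h0 ht] i].
    by split=> [i|]; [have := h (lift ord0 i); rewrite tnthS|exact: h ord0].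
  by have [j ->|->//] := unliftP ord0 i; rewrite tnthS.
rewrite [LHS]product_measure1E//;
  first by rewrite muleC -(IH (fun i => A (lift ord0 i))).
rewrite (_ : [set _ | _] = \bigcap_(i in [set: 'I_n])
    ((fun x : Rspace R n => tnth x i) @^-1` A (lift ord0 i))); last first.
  by apply/seteqP; split => x /= h i; [move=> _; exact: h|exact: (h i I)].
apply: fin_bigcap_measurable => // i _.
by rewrite -[X in measurable X]setTI; exact: measurable_tnth.
Qed.

End lebesgue_tuple.

Section fractional_heat.
Variables (R : realType) (n : nat).
Local Notation space := (Rspace R n).
Local Notation spacetime := (Rspacetime R n).

Definition lebesgue_spacetime : {sigma_finite_measure set spacetime -> \bar R} :=
  times_lebesgue (lebesgue_tuple R n).
Local Notation mu := lebesgue_spacetime.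

Definition subv (x y : space) : space := [tuple tnth x i - tnth y i | i < n].

Definition enorm (x : space) : R := Num.sqrt (\sum_(i < n) tnth x i ^+ 2).

Definition Gamma (a : R) : R :=
  \int[@lebesgue_measure R]_(t in `]0, +oo[) (t `^ (a - 1) * expR (- t)).

Definition heat_kernel (a : R) (z : spacetime) : R :=
  if 0 < z.2 then
    z.2 `^ (a - 1) / Gamma a * ((4 * pi * z.2) `^ (n%:R / 2))^-1
      * expR (- (enorm z.1 ^+ 2 / (4 * z.2)))
  else 0.

(* The value is an extended real: the convention +oo - oo = -oo of the
   library makes it finite exactly when the integral converges absolutely. *)
Definition heat_potential (a : R) (f : spacetime -> R) (z : spacetime) : \bar R :=
  (\int[mu]_(w in [set w : spacetime | (w.2 < z.2)%R])
     (heat_kernel a (subv z.1 w.1, z.2 - w.2) * f w)%:E)%E.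

(* The norm of the space L^p(D), for p in [1, +oo]. *)
Definition Lnorm_on (D : set spacetime) (p : \bar R) (f : spacetime -> R)
    : \bar R :=
  ('N[mu]_p [EFin \o (f \_ D)])%E.

Definition Xspace (p : R) : set (spacetime -> R) :=
  [set f | measurable_fun setT f /\
    forall T : R, (Lnorm_on [set z | (z.2 < T)%R] p%:E f < +oo)%E].

Definition Yspace (p a : R) : set (spacetime -> R) :=
  [set u | measurable_fun setT u /\
    exists2 f, Xspace p f & EFin \o u = heat_potential a f %[ae mu]].

(* The operator (d_t - Delta)^a : Y^p_a -> X^p, the inverse of the bijection
   J_a : X^p -> Y^p_a, is given by its graph: [frac_heat p a u f] means that
   f = (d_t - Delta)^a u.  Functions equal almost everywhere are identified,
   so f is determined by u only up to a null set. *)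
Definition frac_heat (p a : R) (u f : spacetime -> R) : Prop :=
  [/\ Yspace p a u, Xspace p f & EFin \o u = heat_potential a f %[ae mu]].

Definition parabolic_cylinder (t : R) : set spacetime :=
  [set z | enorm z.1 < Num.sqrt t /\ t < z.2 < 2 * t].

End fractional_heat.

(* Main.v *)
Require Import Defs.
From HB Require Import structures.
From mathcomp Require Import all_boot all_order all_algebra.
From mathcomp Require Import all_classical all_reals all_analysis.
From mathcomp Require Import ess_sup_inf measurable_realfun.
From mathcomp Require Import ring lra.

Set Implicit Arguments.
Unset Strict Implicit.
Unset Printing Implicit Defensive.
Import Order.TTheory GRing.Theory Num.Theory.
Import numFieldNormedType.Exports.

Local Open Scope classical_set_scope.
Local Open Scope ring_scope.

(* The solutions are built on self-similar profiles: with [t] the time elapsed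
   since the last integer time [k], put [f = A t^-a] and [g = B t^-b] on the
   parabolic horn where all coordinates of x lie in (0, sqrt t), for every
   integer [k >= n + 2], and [u = J_alpha f], [v = J_beta g]. By parabolic
   scaling u and v are at least of order [A t^(alpha - a)] and [B t^(beta - b)]
   on the horn, so that [f <= v^lambda] and [g <= u^sigma] hold as soon as
   [a = lambda (b - beta)] and [b = sigma (a - alpha)], A and B being adjusted
   afterwards. This linear system gives [r0 = (n + 2) / (2 a)] and
   [s0 = (n + 2) / (2 b)]. The section of a horn at age t has measure
   [t^(n / 2)], hence [f] is in L^r near its singularities exactly when
   [r < r0]; as [p < r0], f is in X^p, while its L^r norm is infinite next to
   the time k, inside the cylinder of [t_j = k]. *)

(** * Integrals of powers over bounded intervals, and positivity of [Gamma] *)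

Section power_integrals.
Variable R : realType.
Local Notation leb := (@lebesgue_measure R).
Implicit Types (a c d e t x y : R).

Lemma measurable_powR_shift c e :
  measurable_fun [set: R] (fun t => (t - c) `^ e).
Proof.
apply: (measurableT_comp (measurable_powR e)).
by apply: measurable_funB => //; exact: measurable_cst.
Qed.

Lemma is_derive_shift c (F : R -> R) t l :
  is_derive (t - c) 1 F l -> is_derive t 1 (fun x => F (x - c)) l.
Proof.
move=> h.
have h2 : is_derive t 1 (fun x : R => x - c) 1.
  by apply: is_derive_eq; rewrite subr0.
have := @is_derive1_comp R F (fun x : R => x - c) t l 1 h h2.
by rewrite mulr1.
Qed.

(** [f] and [F] are constrained only at positive arguments, because [[x, d]] keeps away from [c];
    this admits powers with negative exponent and [ln]. *)
Lemma FTC2_shift c d x (f F : R -> R) : c < x -> x < d ->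
  (forall y : R, 0 < y -> is_derive y 1 F (f y)) ->
  (forall y : R, 0 < y -> {for y, continuous f}) ->
  (\int[leb]_(t in `[x, d]) (f (t - c))%:E = (F (d - c) - F (x - c))%:E)%E.
Proof.
move=> cx xd dF cf.
have dG t : c < t -> is_derive t 1 (fun y => F (y - c)) (f (t - c)).
  by move=> ct; apply: is_derive_shift; apply: dF; rewrite subr_gt0.
have cG t : c < t -> {for t, continuous (fun y => F (y - c))}.
  move=> ct; apply: differentiable_continuous; apply/derivable1_diffP.
  by have [] := dG _ ct.
rewrite EFinB; apply: (@continuous_FTC2 _ (fun t => f (t - c)) (fun t => F (t - c))) => //.
- apply: continuous_in_subspaceT => t; rewrite inE /= in_itv /= => /andP[xt _].
  apply: continuous_comp; last by apply: cf; rewrite subr_gt0 (lt_le_trans cx).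
  by apply: cvgB; [exact: cvg_id|exact: cvg_cst].
- split.
  + by move=> t; rewrite in_itv /= => /andP[xt _]; have [] := dG t (lt_trans cx xt).
  + by apply: cvg_at_right_filter; exact: cG.
  + by apply: cvg_at_left_filter; apply: cG; exact: lt_trans xd.
- move=> t; rewrite in_itv /= => /andP[xt _].
  by rewrite derive1E; have [_ ->] := dG t (lt_trans cx xt).
Qed.

(** The intervals [[x k, d]] increase to []c, d]]. On each of them the fundamental theorem applies,
    and dropping the nonnegative value of the primitive at the left end gives a bound uniform in
    [k]. *)
Lemma integral_powR_shift_le c d e : -1 < e -> c < d ->
  (\int[leb]_(t in `]c, d[) ((t - c) `^ e)%:E <=
   ((d - c) `^ (e + 1) / (e + 1))%:E)%E.
Proof.
move=> e1 cd.
have e0 : 0 < e + 1 by lra.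
have mf : measurable_fun [set: R] (fun t : R => ((t - c) `^ e)%:E).
  by apply/measurable_EFinP; exact: measurable_powR_shift.
(* [k.+2] keeps [x k] strictly below [d] for [k = 0] as well. *)
pose x (k : nat) : R := c + (d - c) / (k.+2)%:R.
have cxd k : c < x k < d.
  rewrite /x ltrDl divr_gt0 ?subr_gt0 ?ltr0n //= -ltrBrDl.
  by rewrite ltr_pdivrMr ?ltr0n// ltr_pMr ?subr_gt0 // ltr1n.
have xP : `]c, d]%classic = \bigcup_k `[x k, d]%classic.
  apply/seteqP; split=> t /=; last first.
    move=> [k _] /=; rewrite !in_itv /= => /andP[xt ->]; rewrite andbT.
    by have /andP[h _] := cxd k; exact: lt_le_trans xt.
  rewrite in_itv /= => /andP[ct td].
  have tc : 0 < t - c by rewrite subr_gt0.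
  exists (Num.truncn ((d - c) / (t - c))) => //=; rewrite in_itv /= td andbT.
  rewrite /x -lerBrDl ler_pdivrMr ?ltr0n// mulrC -ler_pdivrMr//.
  apply: le_trans (ltW (truncnS_gt _)) _; by rewrite ler_nat.
apply: (@le_trans _ _ (\int[leb]_(t in `]c, d]) ((t - c) `^ e)%:E)%E).
  apply: ge0_subset_integral => //=.
  - exact: measurable_funS mf.
  - by move=> t _; rewrite lee_fin powR_ge0.
  - by move=> t /=; rewrite !in_itv /= => /andP[-> /ltW ->].
rewrite xP.
have cvgI : (\int[leb]_(t in `[x k, d]) ((t - c) `^ e)%:E @[k --> \oo] -->
    \int[leb]_(t in \bigcup_k `[x k, d]%classic) ((t - c) `^ e)%:E)%E.
  apply: (@ge0_nondecreasing_set_cvg_integral _ (measurableTypeR R) R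
    (fun k => `[x k, d]%classic) (fun t => ((t - c) `^ e)%:E) leb) => //.
  - move=> k l kl; rewrite subsetEset => t /=; rewrite !in_itv /= => /andP[h ->].
    rewrite andbT; apply: le_trans h; rewrite /x lerD2l ler_pM2l ?subr_gt0//.
    by rewrite lef_pV2 ?posrE ?ltr0n// ler_nat.
  - by move=> k; exact: measurable_funS mf.
  - by move=> k t _; rewrite lee_fin powR_ge0.
rewrite -(cvg_lim _ cvgI) //.
apply: lime_le; first exact: cvgP cvgI.
apply: nearW => k; have /andP[ck kd] := cxd k.
have dF (y : R) : 0 < y -> is_derive y 1 (fun t : R => t `^ (e + 1) / (e + 1)) (y `^ e).
  move=> y0; have h := @is_derive1_powR R (e + 1) y y0.
  have h2 := @is_deriveM R _ (fun x => x `^ (e + 1)) (fun=> (e + 1)^-1) y 1 _ _ h (is_derive_cst _ _ _).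
  apply: is_derive_eq h2 _.
  by rewrite /= scaler0 add0r addrK /GRing.scale /= mulrA mulVf ?mul1r// gt_eqF.
have cF (y : R) : 0 < y -> {for y, continuous (fun t : R => t `^ e)}.
  move=> y0; apply: differentiable_continuous; apply/derivable1_diffP.
  by have [] := @is_derive1_powR R e y y0.
rewrite (FTC2_shift ck kd dF cF).
by rewrite lee_fin lerBlDr lerDl divr_ge0 ?powR_ge0 ?ltW.
Qed.

Lemma integral_powR_shift_lty c d e : -1 < e -> c < d ->
  (\int[leb]_(t in `]c, d[) ((t - c) `^ e)%:E < +oo)%E.
Proof.
by move=> e1 cd; apply: le_lt_trans (integral_powR_shift_le e1 cd) _; exact: ltry.
Qed.

Lemma integral_inv_shift_pinfty c d : c < d ->
  (\int[leb]_(t in `]c, d[) ((t - c)^-1)%:E = +oo)%E.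
Proof.
move=> cd.
have mf : measurable_fun [set: R] (fun t : R => ((t - c) `^ (-1))%:E).
  by apply/measurable_EFinP; exact: measurable_powR_shift.
have -> : (\int[leb]_(t in `]c, d[) ((t - c)^-1)%:E)%E =
    (\int[leb]_(t in `]c, d[) ((t - c) `^ (-1))%:E)%E.
  apply: eq_integral => t; rewrite inE /= in_itv /= => /andP[ct _].
  by rewrite powR_inv1 // subr_ge0 ltW.
rewrite -(integral_itv_bndoo false false); last exact: measurable_funS mf.
apply/eqyP => M M0.
(* Chosen so that the primitive [ln] grows by exactly [M] between [x - c] and [d - c]. *)
pose x := c + (d - c) * expR (- M).
have xc : c < x by rewrite ltrDl mulr_gt0 ?expR_gt0// subr_gt0.
have xd : x < d.
  rewrite /x -ltrBrDl gtr_pMr ?subr_gt0// -expR0 ltr_expR; lra.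
apply: (@le_trans _ _ (\int[leb]_(t in `[x, d]) ((t - c) `^ (-1))%:E)%E); last first.
  apply: ge0_subset_integral => //=.
  - exact: measurable_funS mf.
  - by move=> t _; rewrite lee_fin powR_ge0.
  - by move=> t /=; rewrite !in_itv /= => /andP[xt ->]; rewrite andbT (lt_le_trans xc).
have dln (y : R) : 0 < y -> is_derive y 1 (@ln R) (y `^ (-1)).
  by move=> y0; rewrite powR_inv1 ?ltW//; exact: is_derive1_ln.
have cinv (y : R) : 0 < y -> {for y, continuous (fun t : R => t `^ (-1))}.
  move=> y0; apply: differentiable_continuous; apply/derivable1_diffP.
  by have [] := @is_derive1_powR R (-1) y y0.
rewrite (FTC2_shift xc xd dln cinv).
rewrite lee_fin /x addrAC subrr add0r lnM ?posrE ?subr_gt0 ?expR_gt0// expRK.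
lra.
Qed.

(** [Gamma] is the [fine] part of an integral and would be 0 if that integral were infinite, so
    positivity requires finiteness as well. Near 0 the integrand is at most [t^(a - 1)], integrable
    since [a > 0]; on [[1, +oo[] an exponential density dominates it. *)
Lemma Gamma_gt0 (a : R) : 0 < a -> 0 < Gamma a.
Proof.
move=> a0.
pose g (t : R) := (t `^ (a - 1) * expR (- t))%:E.
have mg : measurable_fun [set: R] g.
  apply/measurable_EFinP; apply: measurable_funM; first exact: measurable_powR.
  by apply: measurableT_comp => //; exact: measurable_oppr.
have g0 t : (0 <= g t)%E by rewrite lee_fin mulr_ge0 ?powR_ge0 ?expR_ge0.
have itvU : `]0, +oo[%classic = `]0, 1[%classic `|` `[1, +oo[%classic :> set R.
  apply/seteqP; split=> t /=; rewrite !in_itv /= ?andbT => h.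
    by have [t1|t1] := ltP t 1; [left|right]; rewrite ?h.
  by case: h => [/andP[]//|]; apply: lt_le_trans.
have [k ka] : exists k : nat, a - 1 <= k.+1%:R.
  by exists (Num.truncn (a - 1)); exact: ltW (truncnS_gt _).
(* Comes from [t^(k+1) <= (k+1)! 2^(k+1) exp(t / 2)]; one more factor 2 offsets the factor 1/2 in
   the exponential density of rate 1/2. *)
pose C : R := (k.+1)`!%:R * 2 ^+ k.+2.
have gC t : 1 <= t -> (g t <= (C * exponential_pdf 2^-1 t)%:E)%E.
  move=> t1; have t0 : 0 <= t by lra.
  rewrite lee_fin exponential_pdfE// /C exprS.
  have e1 : t `^ (a - 1) <= t ^+ k.+1.
    by rewrite -powR_mulrn// ler_powR.
  have e2 : t ^+ k.+1 <= k.+1`!%:R * 2 ^+ k.+1 * expR (2^-1 * t).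
    have := @expR_ge1Dxn R (2^-1 * t) k; rewrite mulr_ge0// => /(_ isT).
    have f0 : 0 < k.+1`!%:R * 2 ^+ k.+1 :> R.
      by rewrite mulr_gt0 ?ltr0n ?fact_gt0 ?exprn_gt0.
    rewrite -ler_pdivrMl//; apply: le_trans.
    rewrite exprMn exprVn invfM.
    set X := t ^+ _; set Y := 2 ^+ _; set Z := _%:R.
    rewrite (_ : Z^-1 / Y * X = Y^-1 * X / Z); last by ring.
    by rewrite lerDr.
  have e3 : expR (- t) = expR (- 2^-1 * t) * expR (- 2^-1 * t).
    by rewrite -expRD; congr expR; lra.
  have e4 : expR (2^-1 * t) * expR (- 2^-1 * t) = 1.
    by rewrite -expRD (_ : _ + _ = 0) ?expR0//; lra.
  rewrite e3.
  apply: (@le_trans _ _ (k.+1`!%:R * 2 ^+ k.+1 * expR (2^-1 * t) *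
     (expR (- 2^-1 * t) * expR (- 2^-1 * t)))).
    by rewrite ler_wpM2r ?mulr_ge0 ?expR_ge0// (le_trans e1).
  rewrite le_eqVlt; apply/orP; left; apply/eqP.
  move: e4; set E1 := expR (2^-1 * t); set E2 := expR _; set Y := 2 ^+ _; set Z := _%:R.
  move=> e4; rewrite (_ : Z * Y * E1 * (E2 * E2) = Z * Y * (E1 * E2) * E2); last by ring.
  by rewrite e4; field.
have fin : (\int[leb]_(t in `]0%R, +oo[) g t < +oo)%E.
  rewrite itvU ge0_integral_setU//; last 2 first.
  - exact: measurable_funTS.
  - apply/disj_set2P; apply/seteqP; split=> t //= [].
    by rewrite !in_itv /= andbT => /andP[_ +] => /lt_geF ->.
  apply: lte_add_pinfty.
    have := @integral_powR_shift_lty 0 1 (a - 1); rewrite ltr01 => /(_ _ isT).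
    move=> /(_ ltac:(lra)); apply: le_lt_trans.
    apply: ge0_le_integral => //.
    - exact: measurable_funTS.
    - by apply: measurable_funTS; apply/measurable_EFinP; exact: measurable_powR_shift.
    - move=> t /=; rewrite in_itv /= => /andP[t0 _].
      rewrite lee_fin subr0 ler_piMr ?powR_ge0// -expR0 ler_expR; lra.
  apply: (@le_lt_trans _ _ (\int[leb]_(t in `[1%R, +oo[) (C%:E * (exponential_pdf 2^-1 t)%:E))%E).
    apply: ge0_le_integral => //.
    - exact: measurable_funTS.
    - apply: measurable_funTS; apply: measurable_funeM.
      by apply/measurable_EFinP; exact: measurable_exponential_pdf.
    - by move=> t /=; rewrite in_itv /= andbT => /gC.
  have C0 : 0 <= C by rewrite mulr_ge0 ?exprn_ge0.
  have mE : measurable_fun [set: R] (fun t => (exponential_pdf (2^-1 : R) t)%:E).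
    by apply/measurable_EFinP; exact: measurable_exponential_pdf.
  have E0 (t : R) : (0 <= (exponential_pdf (2^-1 : R) t)%:E)%E.
    by rewrite lee_fin exponential_pdf_ge0.
  rewrite ge0_integralZl//; last exact: measurable_funTS.
  apply: (@le_lt_trans _ _ (C%:E * (\int[leb]_t (exponential_pdf 2^-1 t)%:E))%E).
    by apply: lee_wpmul2l; [rewrite lee_fin|exact: ge0_subset_integral].
  by rewrite integral_exponential_pdf ?mule1 ?ltry// invr_gt0.
(* On []1, 2[], writing [t^(a - 1) = t^a / t >= 1 / 2] avoids a case distinction on the sign of
   [a - 1]. *)
have pos : (0 < \int[leb]_(t in `]0%R, +oo[) g t)%E.
  apply: (@lt_le_trans _ _ (\int[leb]_(t in `]1%R, 2%R[) (2^-1 * expR (- 2))%:E)%E).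
    have l12 : leb `]1, 2[%classic = 1%E.
      rewrite lebesgue_measure_itv /= lte_fin ltr1n -EFinD; congr EFin; lra.
    rewrite integral_cst//; rewrite [X in (_ * X)%E]l12 mule1 lte_fin.
    by rewrite mulr_gt0 ?expR_gt0 ?invr_gt0.
  apply: (@le_trans _ _ (\int[leb]_(t in `]1%R, 2%R[) g t)%E).
    apply: ge0_le_integral => //.
    - exact: measurable_funTS.
    - move=> t /=; rewrite in_itv /= => /andP[t1 t2].
      have t0 : 0 < t by lra.
      rewrite lee_fin ler_pM ?expR_ge0 ?invr_ge0// ?ler_expR; last lra.
      rewrite powRB ?(gt_eqF t0) ?implybT// powRr1 ?(ltW t0)//.
      apply: (@le_trans _ _ t^-1).
        by rewrite lef_pV2 ?posrE// ltW.
      rewrite -[leLHS]mul1r ler_pM2r ?invr_gt0//.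
      by rewrite -[leLHS](powRr0 t); apply: ler_powR; exact: ltW.
  apply: ge0_subset_integral => //.
    exact: measurable_funTS.
  by move=> t /=; rewrite !in_itv /= andbT => /andP[+ _]; apply: lt_trans.
by rewrite /Gamma /Rintegral fine_gt0// pos fin.
Qed.

End power_integrals.

(** * Gaussian factorization, mass and measurability of the heat kernel *)

Section heat_kernel_integral.
Variable R : realType.
Local Notation leb := (@lebesgue_measure R).

(** Induction on the dimension: [lebesgue_tuple] is a pushforward of a product measure, so Tonelli's
    theorem splits off the head coordinate. *)
Lemma ge0_integral_lebesgue_tuple_prod n (g : 'I_n -> R -> R) :
  (forall i, measurable_fun [set: measurableTypeR R] (g i)) ->
  (forall i t, 0 <= g i t) ->
  (\int[lebesgue_tuple R n]_x (\prod_(i < n) g i (tnth x i))%R%:E =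
   \prod_(i < n) \int[leb]_t (g i t)%:E)%E.
Proof.
elim: n g => [|n IH] g mg g0.
  rewrite big_ord0 /= integral_dirac//; last first.
    by apply/measurable_EFinP; apply: measurable_prod => i _; case: i.
  by rewrite diracT mul1e big_ord0.
have mP k (h : 'I_k -> R -> R) : (forall i, measurable_fun [set: measurableTypeR R] (h i)) ->
    measurable_fun [set: Rspace R k] (fun x => \prod_(i < k) h i (tnth x i)).
  move=> mh; apply: measurable_prod => i _.
  by apply: (measurableT_comp (mh i)); exact: measurable_tnth.
have P0 k (h : 'I_k -> R -> R) (x : Rspace R k) : (forall i t, 0 <= h i t) ->
    0 <= \prod_(i < k) h i (tnth x i).
  by move=> h0; apply: prodr_ge0.
rewrite big_ord_recl /=.
rewrite [LHS](ge0_integral_pushforward (@measurable_cons_pair R n))//; last 2 first.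
- by apply/measurable_EFinP; exact: mP.
- by move=> x _; rewrite lee_fin P0.
rewrite preimage_setT.
have -> : (\int[times_lebesgue (lebesgue_tuple R n)]_x
    ((fun y : Rspace R n.+1 => (\prod_(i < n.+1) g i (tnth y i))%R%:E) \o
      cons_pair (n:=n)) x)%E =
  (\int[(lebesgue_tuple R n \x leb)%E]_z
    ((\prod_(i < n) g (lift ord0 i) (tnth z.1 i))%R%:E * (g ord0 z.2)%:E))%E.
  apply: eq_integral => z _ /=; rewrite big_ord_recl mulrC EFinM.
  by congr (_ * _)%E; congr EFin; apply: eq_bigr => i _; rewrite tnthS.
rewrite fubini_tonelli1 //=; last 2 first.
- apply/measurable_EFinP; apply: measurable_funM.
    apply: (measurableT_comp (mP n (fun i => g (lift ord0 i)) _)) => //.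
  by apply: (measurableT_comp (mg ord0)); exact: measurable_snd.
- by move=> z; rewrite -EFinM lee_fin mulr_ge0//; apply: prodr_ge0.
rewrite /fubini_F /=.
under eq_integral => x _.
  rewrite ge0_integralZl//; last 3 first.
  - by apply/measurable_EFinP.
  - by move=> t _; rewrite lee_fin.
  - by rewrite lee_fin; apply: prodr_ge0.
  over.
rewrite ge0_integralZr//; last 3 first.
- by apply/measurable_EFinP; exact: (mP n (fun i => g (lift ord0 i))).
- by move=> x _; rewrite lee_fin; apply: prodr_ge0.
- by apply: integral_ge0 => t _; rewrite lee_fin.
by rewrite (IH (fun i => g (lift ord0 i)))// muleC.
Qed.

Variable n : nat.
Local Notation space := (Rspace R n).
Local Notation spacetime := (Rspacetime R n).

Lemma measurable_slab (J : set (measurableTypeR R)) : measurable J ->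
  measurable [set z : spacetime | J z.2].
Proof. by move=> mJ; rewrite -[X in measurable X]setTI; exact: measurable_snd. Qed.

Definition cube (l : R) : set space :=
  [set x | forall i, `]0, l[%classic (tnth x i)].

Lemma measurable_cube l : measurable (cube l).
Proof.
rewrite (_ : cube l = \bigcap_(i in [set: 'I_n])
    (fun x => tnth x i) @^-1` `]0, l[%classic).
  apply: fin_bigcap_measurable => // i _.
  by rewrite -[X in measurable X]setTI; exact: measurable_tnth.
by apply/seteqP; split => x h i; [move=> _; exact: h|exact: (h i I)].
Qed.

Lemma lebesgue_tuple_cube l : 0 <= l -> lebesgue_tuple R n (cube l) = (l ^+ n)%:E.
Proof.
move=> l0; rewrite (@lebesgue_tuple_box R n (fun=> `]0, l[%classic))//.
rewrite (eq_bigr (fun=> l%:E)); last first.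
  move=> i _; rewrite lebesgue_measure_itv /= lte_fin; case: ltP => h.
    by rewrite -EFinD subr0.
  by congr EFin; apply/eqP; rewrite eq_le h l0.
by rewrite prodEFin prodr_const card_ord.
Qed.

(** The Gaussian is a product of normal densities of variance [2 * s] centred at the coordinates of
    [y]; its integral over space then needs no change of variables. *)
Lemma heat_kernelE a (x y : space) s : 0 < s ->
  heat_kernel a (subv x y, s) =
  s `^ (a - 1) / Gamma a *
    \prod_(i < n) normal_pdf (tnth y i) (Num.sqrt (2 * s)) (tnth x i).
Proof.
move=> s0; rewrite /heat_kernel /= s0.
have s2 : 0 < 2 * s by lra.
have sq2 : Num.sqrt (2 * s) ^+ 2 = 2 * s by rewrite sqr_sqrtr// ltW.
rewrite -!mulrA; congr (_ * (_ * _)).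
under eq_bigr => i _.
  rewrite normal_pdfE ?gt_eqF ?sqrtr_gt0// /normal_peak /normal_fun sq2.
  rewrite (_ : 2 * s * pi *+ 2 = 4 * pi * s); last by rewrite -mulr_natr; ring.
  rewrite (_ : 2 * s *+ 2 = 4 * s); last by rewrite -mulr_natr; ring.
  over.
rewrite big_split /= prodr_const card_ord -expR_sum.
congr (_ * expR _).
  rewrite -powR12_sqrt; last by rewrite !mulr_ge0 ?pi_ge0// ltW.
  by rewrite exprVn -powR_mulrn ?powR_ge0// -powRrM mulrA (mulrC 2^-1).
rewrite /enorm.
rewrite mulrA -expr2 sqr_sqrtr; last by apply: sumr_ge0 => i _; exact: sqr_ge0.
rewrite mulr_suml -sumrN; apply: eq_bigr => i _.
by rewrite tnth_mktuple mulNr.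
Qed.

Lemma integral_heat_kernel a (y : space) s : 0 < a -> 0 < s ->
  (\int[lebesgue_tuple R n]_x (heat_kernel a (subv x y, s))%:E =
   (s `^ (a - 1) / Gamma a)%:E)%E.
Proof.
move=> a0 s0.
under eq_integral do rewrite heat_kernelE// EFinM.
have mP : measurable_fun [set: Rspace R n] (fun x =>
    \prod_(i < n) normal_pdf (tnth y i) (Num.sqrt (2 * s)) (tnth x i)).
  apply: measurable_prod => i _.
  apply: (measurableT_comp (measurable_normal_pdf _ _)); exact: measurable_tnth.
rewrite ge0_integralZl//; last 3 first.
- exact/measurable_EFinP.
- by move=> x _; rewrite lee_fin prodr_ge0// => i _; exact: normal_pdf_ge0.
- by rewrite lee_fin divr_ge0 ?powR_ge0// ltW// Gamma_gt0.
rewrite (ge0_integral_lebesgue_tuple_prod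
  (g := fun i t => normal_pdf (tnth y i) (Num.sqrt (2 * s)) t)).
- under eq_bigr do rewrite integral_normal_pdf.
  by rewrite big1 ?mule1.
- by move=> i; exact: measurable_normal_pdf.
- by move=> i t; exact: normal_pdf_ge0.
Qed.

Lemma measurable_invr : measurable_fun [set: measurableTypeR R] (@GRing.inv R).
Proof.
(* [powR] with exponent -1 agrees with the inverse only on nonnegative reals, both taking 0 to 0;
   oddness covers the rest. *)
rewrite (_ : GRing.inv = fun x : R =>
    if 0 <= x then x `^ (-1) else - ((- x) `^ (-1))); last first.
  apply/funext => x; case: ifPn => x0; first by rewrite powR_inv1.
  by rewrite powR_inv1 ?invrN ?opprK// oppr_ge0 ltW// ltNge.
apply: measurable_fun_ifT.
- by apply: measurable_fun_ler.
- exact: measurable_powR.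
- apply: measurableT_comp => //.
  by apply: (measurableT_comp (measurable_powR _)).
Qed.

Lemma measurable_sqrtr : measurable_fun [set: measurableTypeR R] (@Num.sqrt R).
Proof. by apply: continuous_measurable_fun; exact: sqrt_continuous. Qed.

Lemma measurable_enorm : measurable_fun [set: space] (@enorm R n).
Proof.
apply: (measurableT_comp measurable_sqrtr).
apply: measurable_sum => i; apply: measurable_funX.
exact: measurable_tnth.
Qed.

Lemma measurable_heat_kernel a : measurable_fun [set: spacetime] (@heat_kernel R n a).
Proof.
apply: measurable_fun_ifT => //.
  by apply: measurable_fun_ltr => //; exact: measurable_snd.
apply: measurable_funM; first apply: measurable_funM.
- apply: measurable_funM => //.
  by apply: (measurableT_comp (measurable_powR _)); exact: measurable_snd.
- under eq_fun do rewrite -powRN.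
  apply: (measurableT_comp (measurable_powR _)).
  by apply: measurable_funM => //; exact: measurable_snd.
apply: measurableT_comp => //; apply: measurableT_comp => //.
apply: measurable_funM.
  apply: measurable_funX; apply: (measurableT_comp measurable_enorm).
  exact: measurable_fst.
apply: (measurableT_comp measurable_invr).
by apply: measurable_funM => //; exact: measurable_snd.
Qed.

Lemma measurable_heat_kernel_shift a : measurable_fun [set: spacetime * spacetime]
  (fun zw => heat_kernel a (subv zw.1.1 zw.2.1, zw.1.2 - zw.2.2)).
Proof.
apply: (measurableT_comp (measurable_heat_kernel a)).
apply: measurable_fun_pair.
- apply/measurable_fun_tnthP => i.
  rewrite (_ : _ \o _ = (fun zw : spacetime * spacetime => tnth zw.1.1 i - tnth zw.2.1 i)); last first.
    by apply/funext => zw /=; rewrite tnth_mktuple.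
  apply: measurable_funB.
    apply: (measurableT_comp (measurable_tnth i)).
    by apply: (measurableT_comp measurable_fst); exact: measurable_fst.
  apply: (measurableT_comp (measurable_tnth i)).
  by apply: (measurableT_comp measurable_fst); exact: measurable_snd.
- apply: measurable_funB.
    by apply: (measurableT_comp measurable_snd); exact: measurable_fst.
  by apply: (measurableT_comp measurable_snd); exact: measurable_snd.
Qed.

Lemma heat_kernel_ge0 a z : 0 < a -> 0 <= @heat_kernel R n a z.
Proof.
move=> a0; rewrite /heat_kernel; case: ifP => // _.
by rewrite !mulr_ge0 ?expR_ge0 ?invr_ge0 ?powR_ge0 ?ltW// Gamma_gt0.
Qed.

End heat_kernel_integral.

(** * Potentials of nonnegative functions: measurability and finiteness almost everywhere *)

Section heat_potential.
Variables (R : realType) (n : nat).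
Local Notation leb := (@lebesgue_measure R).
Local Notation space := (Rspace R n).
Local Notation spacetime := (Rspacetime R n).
Local Notation mu := (lebesgue_spacetime R n).
Variables (a : R) (f : spacetime -> R).
Hypotheses (a0 : 0 < a) (mf : measurable_fun [set: spacetime] f).
Hypothesis f0 : forall z, 0 <= f z.

Let K (z w : spacetime) := heat_kernel a (subv z.1 w.1, z.2 - w.2).

Let K_ge0 z w : 0 <= K z w.
Proof. exact: heat_kernel_ge0. Qed.

Let K_eq0 z w : z.2 <= w.2 -> K z w = 0.
Proof. by move=> zw; rewrite /K /heat_kernel /= subr_gt0 ltNge zw. Qed.

Let measurable_K : measurable_fun [set: spacetime * spacetime] (fun zw => K zw.1 zw.2).
Proof. exact: measurable_heat_kernel_shift. Qed.

Let measurable_lt (T : R) : measurable [set z : spacetime | z.2 < T].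
Proof. exact: (@measurable_slab R n `]-oo, T[%classic). Qed.

(** The kernel vanishes when the source is not earlier than [z]. The domain of integration thus no
    longer depends on [z], which suits Tonelli's theorem. *)
Lemma heat_potentialE z :
  heat_potential a f z = (\int[mu]_w (K z w * f w)%:E)%E.
Proof.
rewrite /heat_potential integral_mkcond; apply: eq_integral => w _.
rewrite patchE; case: ifPn => //.
by rewrite notin_setE /= => /negP; rewrite -leNgt => /K_eq0 ->; rewrite mul0r.
Qed.

Lemma heat_potential_ge0 z : (0 <= heat_potential a f z)%E.
Proof.
by rewrite heat_potentialE; apply: integral_ge0 => w _; rewrite lee_fin mulr_ge0.
Qed.

Lemma measurable_heat_potential :
  measurable_fun [set: spacetime] (heat_potential a f).
Proof.
rewrite (_ : heat_potential a f =
    fubini_F mu (fun zw : spacetime * spacetime => (K zw.1 zw.2 * f zw.2)%:E)); last first.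
  by apply/funext => z; rewrite heat_potentialE.
apply: measurable_fun_fubini_tonelli_F.
  apply/measurable_EFinP; apply: measurable_funM => //.
  by apply: (measurableT_comp mf); exact: measurable_snd.
by move=> zw; rewrite lee_fin mulr_ge0.
Qed.

(** Integrating first in space leaves [(t - w.2)^(a - 1) / Gamma a] on []w.2, T[], with integral at
    most [(T - w.2)^a / (a * Gamma a)]. As [w.2 >= 0], the final bound does not depend on the source
    [w]. *)
Lemma integral_heat_kernel_slab (T : R) (w : spacetime) : 0 <= w.2 < T ->
  (\int[mu]_(z in [set z : spacetime | (z.2 < T)%R]) (K z w)%:E <=
   (T `^ a / a / Gamma a)%:E)%E.
Proof.
move=> /andP[w0 wT].
pose k (z : spacetime) := (((fun z => K z w) \_ [set z : spacetime | (z.2 < T)%R]) z)%:E.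
have mk : measurable_fun [set: spacetime] k.
  apply/measurable_EFinP; apply/(measurable_restrictT _ _).1 => //.
  apply: measurable_funTS.
  exact: (measurable_fun_pair1 w measurable_K).
have k0 z : (0 <= k z)%E by rewrite lee_fin /k patchE; case: ifP.
have -> : (\int[mu]_(z in [set z : spacetime | (z.2 < T)%R]) (K z w)%:E = \int[mu]_z k z)%E.
  rewrite integral_mkcond; apply: eq_integral => z _; rewrite /k !patchE.
  by case: ifP.
have -> : (\int[mu]_z k z = \int[(lebesgue_tuple R n \x leb)%E]_z k z)%E by [].
rewrite fubini_tonelli1// fubini_tonelli// /fubini_G.
have Gt := @Gamma_gt0 R a a0.
apply: (@le_trans _ _ (\int[leb]_(t in `]w.2, T[)
    ((Gamma a)^-1%:E * ((t - w.2) `^ (a - 1))%:E))%E).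
  rewrite [leRHS]integral_mkcond le_eqVlt; apply/orP; left; apply/eqP.
  apply: eq_integral => t _; rewrite patchE; case: ifPn.
    rewrite inE /= in_itv /= => /andP[wt tT].
    rewrite -EFinM mulrC -(@integral_heat_kernel R n a w.1 (t - w.2)) ?subr_gt0//.
    by apply: eq_integral => x _; rewrite /k patchE mem_set.
  rewrite notin_setE /= in_itv /= => /negP; rewrite negb_and -!leNgt => h.
  apply: integral0_eq => x _; rewrite /k patchE.
  by case: ifPn => //; rewrite inE /= => tT; case/orP: h => [h|];
    [rewrite (K_eq0 (z := (x, t)))|rewrite leNgt tT].
have mp : measurable_fun `]w.2, T[ (fun t : R => ((t - w.2) `^ (a - 1))%:E).
  by apply: measurable_funTS; apply/measurable_EFinP; exact: measurable_powR_shift.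
rewrite ge0_integralZl//; last 2 first.
- by move=> t _; rewrite lee_fin powR_ge0.
- by rewrite lee_fin invr_ge0 ltW.
have a1 : -1 < a - 1 by rewrite ltrDr.
rewrite [(_ / Gamma a)%R]mulrC EFinM.
apply: lee_wpmul2l; first by rewrite lee_fin invr_ge0 ltW.
apply: le_trans (integral_powR_shift_le a1 wT) _.
rewrite subrK lee_fin ler_pM2r ?invr_gt0// ge0_ler_powR ?nnegrE ?(ltW a0) ?subr_ge0 ?(ltW wT) ?gerBl ?(ltW (le_lt_trans w0 wT))//.
Qed.

Hypothesis f_past : forall z, z.2 < 0 -> f z = 0.
Hypothesis f_L1 : forall T : R,
  (\int[mu]_(z in [set z : spacetime | (z.2 < T)%R]) (f z)%:E < +oo)%E.

(** After exchanging the integrals, a source [w] contributes [f w] times the mass that its kernel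
    puts below [T], at most [C * f w] by [integral_heat_kernel_slab]. Sources before time 0 carry no
    mass and those after [T] do not act below [T], so [f_L1] concludes. *)
Lemma integral_heat_potential_slab (T : R) :
  (\int[mu]_(z in [set z : spacetime | (z.2 < T)%R]) heat_potential a f z < +oo)%E.
Proof.
pose D := [set z : spacetime | (z.2 < T)%R].
pose k (zw : spacetime * spacetime) := (((fun z => K z zw.2) \_ D) zw.1 * f zw.2)%:E.
have mk : measurable_fun [set: spacetime * spacetime] k.
  apply/measurable_EFinP; apply: measurable_funM; last first.
    by apply: (measurableT_comp mf); exact: measurable_snd.
  rewrite (_ : (fun x : spacetime * spacetime => _) =
    (fun zw => K zw.1 zw.2) \_ (fst @^-1` D)); last first.
    by apply/funext => zw; rewrite !patchE !mem_setE.
  apply/(measurable_restrictT _ _).1; last exact: measurable_funTS.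
  by rewrite -[X in measurable X]setTI; apply: measurable_fst => //; exact: measurable_lt.
have k0 zw : (0 <= k zw)%E.
  by rewrite lee_fin /k mulr_ge0// patchE; case: ifP.
have -> : (\int[mu]_(z in D) heat_potential a f z = \int[mu]_z (fubini_F mu k) z)%E.
  rewrite integral_mkcond; apply: eq_integral => z _.
  rewrite patchE /fubini_F /k; case: ifPn => zD.
    by rewrite heat_potentialE; apply: eq_integral => w _ /=; rewrite patchE zD.
  by rewrite integral0_eq// => w _ /=; rewrite patchE (negbTE zD) mul0r.
rewrite fubini_tonelli// /fubini_G.
pose C := (T `^ a / a / Gamma a).
have C0 : 0 <= C by rewrite !divr_ge0 ?powR_ge0 ?ltW// Gamma_gt0.
apply: (@le_lt_trans _ _ (\int[mu]_(w in D) (C%:E * (f w)%:E))%E); last first.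
  rewrite ge0_integralZl//.
  - by apply: lte_mul_pinfty; rewrite ?lee_fin//; exact: f_L1.
  - exact: measurable_lt.
  - by apply: measurable_funTS; exact/measurable_EFinP.
  - by move=> z _; rewrite lee_fin.
rewrite [leRHS]integral_mkcond.
apply: ge0_le_integral => //.
- by move=> w _; apply: integral_ge0.
- exact: measurable_fun_fubini_tonelli_G.
- apply/(measurable_restrictT _ _).1; first exact: measurable_lt.
  by apply: measurable_funTS; apply: measurable_funeM; exact/measurable_EFinP.
move=> w _; rewrite patchE.
have [w0|w0] := ltP w.2 0.
  rewrite integral0_eq//; last by move=> z _; rewrite /k/= f_past// mulr0.
  by case: ifP => // _; rewrite f_past// mule0.
case: ifPn; last first.
  rewrite notin_setE /= => /negP; rewrite -leNgt => Tw.
  rewrite integral0_eq// => z _; rewrite /k/= patchE; case: ifPn; rewrite ?mul0r//.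
  by rewrite inE /= => zT; rewrite K_eq0 ?mul0r//; exact: ltW (lt_le_trans zT Tw).
rewrite inE /= => wT.
under eq_integral do rewrite /k /= EFinM.
have mKw : measurable_fun [set: spacetime] (fun z => K z w).
  exact: (measurable_fun_pair1 w measurable_K).
rewrite ge0_integralZr//; last 3 first.
- by apply/measurable_EFinP; apply/(measurable_restrictT _ _).1;
    [exact: measurable_lt|exact: measurable_funTS].
- by move=> z _; rewrite lee_fin patchE; case: ifP.
- by rewrite lee_fin.
apply: lee_wpmul2r; first by rewrite lee_fin.
rewrite (_ : (\int[mu]_z _)%E = (\int[mu]_(z in D) (K z w)%:E)%E).
  by apply: integral_heat_kernel_slab; rewrite w0.
rewrite [RHS]integral_mkcond; apply: eq_integral => z _; rewrite !patchE.
by case: ifP.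
Qed.

(** An integrable function is finite almost everywhere; this is applied in each slab [z.2 < k], and
    countably many slabs cover space-time. *)
Lemma heat_potential_fin_num : \forall z \ae mu, heat_potential a f z \is a fin_num.
Proof.
have : \forall z \ae mu, forall k : nat, z.2 < k%:R -> heat_potential a f z \is a fin_num.
  apply/ae_foralln => k.
  apply: (@integrable_ae _ _ _ mu [set z : spacetime | (z.2 < k%:R)%R]) => //.
  apply/integrableP; split; first by apply: measurable_funTS; exact: measurable_heat_potential.
  under eq_integral do rewrite gee0_abs ?heat_potential_ge0//.
  exact: integral_heat_potential_slab.
case=> N [mN N0 sN]; exists N; split => // z /= nz; apply: sN => /= h.
by apply: nz; apply: (h (Num.truncn z.2).+1); exact: truncnS_gt.
Qed.

Lemma heat_potential_past z : z.2 < 0 -> heat_potential a f z = 0%E.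
Proof.
move=> z0; apply: integral0_eq => w /= wz.
by rewrite f_past ?mulr0//; exact: lt_trans z0.
Qed.

Let u z := fine (heat_potential a f z).

Lemma measurable_fine_heat_potential : measurable_fun [set: spacetime] u.
Proof.
by apply: (measurableT_comp (fine_measurable _)) => //; exact: measurable_heat_potential.
Qed.

Lemma fine_heat_potentialE : EFin \o u = heat_potential a f %[ae mu].
Proof.
have [N [mN N0 sN]] := heat_potential_fin_num.
exists N; split => // z /= nz; apply: sN => /= fz; apply: nz => _.
by rewrite /u fineK.
Qed.

Lemma frac_heat_heat_potential p : Xspace p f -> frac_heat p a u f.
Proof.
move=> Xf; split => //; last exact: fine_heat_potentialE.
split; first exact: measurable_fine_heat_potential.
by exists f => //; exact: fine_heat_potentialE.
Qed.

End heat_potential.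

(** * The age of a time, counted from the last integer *)

Section frac_part.
Variable R : realType.
Implicit Types t : R.

Definition frac_part t := t - (Num.floor t)%:~R.

Lemma frac_part_itv t : 0 <= frac_part t < 1.
Proof.
rewrite /frac_part subr_ge0 ltrBlDl; have /andP[-> +] := floor_itv t.
by rewrite intrD addrC.
Qed.

Lemma frac_partE t (k : int) : k%:~R <= t < k%:~R + 1 -> frac_part t = t - k%:~R.
Proof. by move=> h; rewrite /frac_part (@floor_def _ t k)// intrD. Qed.

Lemma measurable_frac_part : measurable_fun [set: measurableTypeR R] frac_part.
Proof.
apply: measurable_funB => //; apply: nondecreasing_measurable => // s t st.
by rewrite ler_int; exact: le_floor.
Qed.

End frac_part.

(** * Self-similar singular profiles and their integrability *)

Section cusp.
Variables (R : realType) (n : nat).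
Local Notation leb := (@lebesgue_measure R).
Local Notation space := (Rspace R n).
Local Notation spacetime := (Rspacetime R n).
Local Notation mu := (lebesgue_spacetime R n).
Implicit Types (A c t T r : R) (z w : spacetime).

(** The start at [n.+2] keeps the horns out of negative times and inside the cylinders: the age is
    below 1, so [|x|^2 <= n < k] on the horn at time [k], and [k + 1 <= 2 * k]. *)
Definition horn : set spacetime := [set z | n.+2%:R <= z.2 /\
  forall i, 0 < tnth z.1 i < Num.sqrt (frac_part z.2)].

Definition cusp A c z := if z \in horn then A * frac_part z.2 `^ (- c) else 0.

Lemma measurable_horn : measurable horn.
Proof.
have mb (b : spacetime -> bool) : measurable_fun [set: spacetime] b ->
    measurable [set z | b z].
  move=> mb; rewrite (_ : mkset _ = b @^-1` [set true]).
    by rewrite -[X in measurable X]setTI; exact: mb.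
  by apply/seteqP; split => z.
have mt (i : 'I_n) : measurable_fun [set: spacetime] (fun z => tnth z.1 i).
  by apply: (measurableT_comp (measurable_tnth i)); exact: measurable_fst.
rewrite (_ : horn = [set z | n.+2%:R <= z.2] `&` \bigcap_(i in [set: 'I_n])
   ([set z | 0 < tnth z.1 i] `&`
    [set z | tnth z.1 i < Num.sqrt (frac_part z.2)])).
  apply: measurableI; first by apply: mb; apply: measurable_fun_ler => //; exact: measurable_snd.
  apply: fin_bigcap_measurable => // i _; apply: measurableI; apply: mb.
    by apply: measurable_fun_ltr; [exact: measurable_cst|exact: mt].
  apply: measurable_fun_ltr; first exact: mt.
  apply: (measurableT_comp (@measurable_sqrtr R)).
  by apply: (measurableT_comp (@measurable_frac_part R)); exact: measurable_snd.
apply/seteqP; split => z /= [z2 h]; split => // i.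
  by move=> _ /=; have /andP[] := h i.
by have [/= -> ->] := h i I.
Qed.

Lemma measurable_cusp A c : measurable_fun [set: spacetime] (cusp A c).
Proof.
apply: (measurable_restrictT (fun z => A * frac_part z.2 `^ (- c)) measurable_horn).1.
apply: measurable_funTS; apply: measurable_funM => //.
apply: (measurableT_comp (measurable_powR _)).
by apply: (measurableT_comp (@measurable_frac_part R)); exact: measurable_snd.
Qed.

Lemma cusp_ge0 A c z : 0 <= A -> 0 <= cusp A c z.
Proof. by move=> A0; rewrite /cusp; case: ifP => // _; rewrite mulr_ge0 ?powR_ge0. Qed.

Lemma cusp_past A c z : z.2 < 0 -> cusp A c z = 0.
Proof.
move=> z0; rewrite /cusp; case: ifPn => //; rewrite inE => -[+ _].
by rewrite leNgt (lt_le_trans z0).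
Qed.

(** Reduces L^r norms of profiles to integrals of profiles. The case [r = 0] fails off the horn,
    where 0 to the power 0 is 1. *)
Lemma cusp_powR A c r z : 0 <= A -> r != 0 ->
  cusp A c z `^ r = cusp (A `^ r) (c * r) z.
Proof.
move=> A0 r0; rewrite /cusp; case: ifP => _; last by rewrite powR0.
by rewrite powRM ?powR_ge0// -powRrM mulNr.
Qed.

Lemma integral_cusp_section A c t : 0 <= A ->
  (\int[lebesgue_tuple R n]_x (cusp A c (x, t))%:E =
   (if n.+2%:R <= t then A * frac_part t `^ (- c) * Num.sqrt (frac_part t) ^+ n
    else 0)%:E)%E.
Proof.
move=> A0; case: ifPn => tn; last first.
  apply: integral0_eq => x _; rewrite /cusp; case: ifPn => //.
  by rewrite inE => -[/= h _]; rewrite h in tn.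
pose B := @cube R n (Num.sqrt (frac_part t)).
have mB : measurable B by exact: measurable_cube.
have -> : (\int[lebesgue_tuple R n]_x (cusp A c (x, t))%:E =
    \int[lebesgue_tuple R n]_(x in B) (A * frac_part t `^ (- c))%:E)%E.
  rewrite [RHS]integral_mkcond; apply: eq_integral => x _; rewrite patchE /cusp.
  have -> : ((x, t) \in horn) = (x \in B); last by case: ifP.
  apply/idP/idP; rewrite !inE.
    by move=> -[_ h] i; rewrite /= in_itv /=; exact: h.
  by move=> h; split => // i; have := h i; rewrite /= in_itv.
have -> : (\int[lebesgue_tuple R n]_(x in B) (A * frac_part t `^ (- c))%:E =
    (A * frac_part t `^ (- c))%:E * lebesgue_tuple R n B)%E.
  exact: (integral_cst (lebesgue_tuple R n) mB).
by rewrite lebesgue_tuple_cube ?sqrtr_ge0// -EFinM.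
Qed.

Lemma integral_cusp A c (J : set (measurableTypeR R)) : 0 <= A -> measurable J ->
  (\int[mu]_(z in [set z : spacetime | J z.2]) (cusp A c z)%:E =
   \int[leb]_(t in J) (if n.+2%:R <= t then
     A * frac_part t `^ (- c) * Num.sqrt (frac_part t) ^+ n else 0)%:E)%E.
Proof.
move=> A0 mJ.
pose k (z : spacetime) := (((cusp A c) \_ [set z : spacetime | J z.2]) z)%:E.
have mk : measurable_fun [set: spacetime] k.
  apply/measurable_EFinP; apply/(measurable_restrictT _ _).1; first exact: measurable_slab.
  by apply: measurable_funTS; exact: measurable_cusp.
have k0 z : (0 <= k z)%E.
  by rewrite lee_fin /k patchE; case: ifP => // _; exact: cusp_ge0.
have -> : (\int[mu]_(z in [set z : spacetime | J z.2]) (cusp A c z)%:E =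
    \int[(lebesgue_tuple R n \x leb)%E]_z k z)%E.
  rewrite integral_mkcond; apply: eq_integral => z _; rewrite /k !patchE.
  by case: ifP.
rewrite fubini_tonelli1// fubini_tonelli// /fubini_G.
rewrite [RHS]integral_mkcond; apply: eq_integral => t _; rewrite patchE.
case: ifPn => tJ.
  rewrite -(integral_cusp_section _ _ A0); apply: eq_integral => x _.
  by rewrite /k patchE mem_set//=; exact: set_mem.
apply: integral0_eq => x _; rewrite /k patchE memNset//=.
by move=> h; rewrite notin_setE in tJ.
Qed.

(** The integral of [cusp A c] over the space slice at time [t]. *)
Let profile A c t : R :=
  if n.+2%:R <= t then A * frac_part t `^ (- c) * Num.sqrt (frac_part t) ^+ n else 0.

Let measurable_profile A c : measurable_fun [set: measurableTypeR R] (EFin \o profile A c).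
Proof.
apply/measurable_EFinP; apply: measurable_fun_ifT => //.
  exact: measurable_fun_ler.
apply: measurable_funM.
  apply: measurable_funM => //; apply: (measurableT_comp (measurable_powR _)).
  exact: measurable_frac_part.
apply: measurable_funX; apply: (measurableT_comp (@measurable_sqrtr R)).
exact: measurable_frac_part.
Qed.

Let profile_ge0 A c t : 0 <= A -> 0 <= profile A c t.
Proof.
by move=> A0; rewrite /profile; case: ifP => // _; rewrite !mulr_ge0 ?powR_ge0 ?exprn_ge0 ?sqrtr_ge0.
Qed.

Let profileE A c (k : nat) t : (n.+2 <= k)%N -> k%:R < t < k.+1%:R ->
  profile A c t = A * (t - k%:R) `^ (n%:R / 2 - c).
Proof.
move=> nk /andP[kt tk]; rewrite /profile.
have -> : n.+2%:R <= t by apply: le_trans (ltW kt); rewrite ler_nat.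
have -> : frac_part t = t - k%:R.
  by rewrite (frac_partE (k := k))//= -[_%:~R]/(k%:R) ltW//= (lt_le_trans tk)// -natr1.
have t0 : 0 < t - k%:R by rewrite subr_gt0.
rewrite -mulrA; congr (_ * _); rewrite (addrC (n%:R / 2)).
rewrite powRD ?(gt_eqF t0) ?implybT//.
congr (_ * _); rewrite -powR12_sqrt ?ltW//.
by rewrite -powR_mulrn ?powR_ge0// -powRrM mulrC.
Qed.

(** Only finitely many horns start below [T], and on each of them the profile is a power of the age
    with exponent [n / 2 - c > -1]. *)
Lemma integral_cusp_lty A c T : 0 <= A -> c < (n%:R + 2) / 2 ->
  (\int[mu]_(z in [set z : spacetime | (z.2 < T)%R]) (cusp A c z)%:E < +oo)%E.
Proof.
move=> A0 cn.
have step (k : nat) :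
  (\int[leb]_(t in `[k%:R, k.+1%:R[) (profile A c t)%:E < +oo)%E.
  have [nk|kn] := leqP n.+2 k; last first.
    rewrite integral0_eq// => t /=; rewrite in_itv /= => /andP[_ tk].
    by rewrite /profile leNgt (lt_le_trans tk)// ler_nat.
  rewrite integral_itv_bndoo; last by apply: measurable_funTS; exact: measurable_profile.
  have -> : (\int[leb]_(t in `]k%:R, k.+1%:R[) (profile A c t)%:E =
     \int[leb]_(t in `]k%:R, k.+1%:R[) (A%:E * ((t - k%:R) `^ (n%:R / 2 - c))%:E))%E.
    by apply: eq_integral => t; rewrite inE /= in_itv /= => h; rewrite (profileE _ _ nk h) EFinM.
  rewrite ge0_integralZl//; last 2 first.
  - by apply: measurable_funTS; apply/measurable_EFinP; exact: measurable_powR_shift.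
  - by move=> t _; rewrite lee_fin powR_ge0.
  apply: lte_mul_pinfty; rewrite ?lee_fin//.
  by apply: integral_powR_shift_lty; [lra|rewrite ltr_nat].
have fin (k : nat) : (\int[leb]_(t in `]-oo, k%:R[) (profile A c t)%:E < +oo)%E.
  elim: k => [|k IH].
    rewrite integral0_eq// => t /=; rewrite in_itv /= => t0.
    by rewrite /profile leNgt (lt_trans t0)// ltr0n.
  have -> : `]-oo, k.+1%:R[%classic = `]-oo, k%:R[%classic `|` `[k%:R, k.+1%:R[%classic :> set R.
    apply/seteqP; split => t /=; rewrite !in_itv /=.
      by move=> tk; have [h|h] := ltP t k%:R; [left|right; apply/andP].
    by case=> [h|/andP[]//]; apply: lt_trans h _; rewrite ltr_nat.
  rewrite ge0_integral_setU//; last 3 first.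
  - by apply: measurable_funTS; exact: measurable_profile.
  - by move=> t _; rewrite lee_fin profile_ge0.
  - apply/disj_set2P; apply/seteqP; split=> t //= [].
    by rewrite !in_itv /= => h /andP[+ _]; rewrite leNgt h.
  by apply: lte_add_pinfty.
rewrite (_ : mkset _ = [set z : spacetime | `]-oo, T[%classic z.2]); last first.
  by apply/seteqP; split => z /=; rewrite in_itv.
rewrite integral_cusp//.
apply: le_lt_trans (fin (Num.truncn T).+1).
apply: ge0_subset_integral => //.
- by apply: measurable_funTS; exact: measurable_profile.
- by move=> t _; rewrite lee_fin profile_ge0.
- by move=> t /=; rewrite !in_itv /= => h; apply: lt_trans h (truncnS_gt _).
Qed.

(** The exponent [(n + 2) / 2] is critical: the volume of the sections turns the integrand into a
    multiple of the inverse of the age, which diverges logarithmically. *)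
Lemma integral_cusp_pinfty A (k : nat) : 0 < A -> (n.+2 <= k)%N ->
  (\int[mu]_(z in [set z : spacetime | (k%:R < z.2 < k.+1%:R)%R])
     (cusp A ((n%:R + 2) / 2) z)%:E = +oo)%E.
Proof.
move=> A0 nk.
rewrite (_ : mkset _ = [set z : spacetime | `]k%:R, k.+1%:R[%classic z.2]); last first.
  by apply/seteqP; split => z /=; rewrite in_itv.
rewrite integral_cusp ?(ltW A0)//.
have -> : (\int[leb]_(t in `]k%:R, k.+1%:R[) (profile A ((n%:R + 2) / 2) t)%:E =
   \int[leb]_(t in `]k%:R, k.+1%:R[) (A%:E * ((t - k%:R)^-1)%:E))%E.
  apply: eq_integral => t; rewrite inE /= in_itv /= => h; rewrite (profileE _ _ nk h) EFinM.
  rewrite (_ : n%:R / 2 - (n%:R + 2) / 2 = -1); last by field.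
  by rewrite powR_inv1// subr_ge0; case/andP: h => /ltW.
rewrite ge0_integralZl//.
- by rewrite integral_inv_shift_pinfty ?ltr_nat// gt0_muley ?lte_fin.
- apply: measurable_funTS; apply/measurable_EFinP.
  by apply: (measurableT_comp (@measurable_invr R)); exact: measurable_funB.
- by move=> t /=; rewrite in_itv /= => /andP[/ltW h _]; rewrite lee_fin invr_ge0 subr_ge0.
- by rewrite lee_fin ltW.
Qed.

Lemma Xspace_cusp A c r : 0 <= A -> 1 <= r -> c * r < (n%:R + 2) / 2 ->
  Xspace r (cusp A c).
Proof.
move=> A0 r1 cr; split; first exact: measurable_cusp.
have r0 : r != 0 by rewrite gt_eqF// (lt_le_trans ltr01).
move=> T; rewrite /Lnorm_on unlock /= poweR_lty//.
rewrite (_ : (\int[_]_x _)%E =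
  (\int[mu]_(z in [set z : spacetime | (z.2 < T)%R]) (cusp (A `^ r) (c * r) z)%:E)%E).
  by apply: integral_cusp_lty => //; exact: powR_ge0.
rewrite [RHS]integral_mkcond; apply: eq_integral => z _ /=.
rewrite !patchE; case: ifP => _; last by rewrite normr0 powR0.
by rewrite ger0_norm ?cusp_ge0// cusp_powR.
Qed.

End cusp.

(** * Lower bound for the potential of a profile *)

Section potential_of_cusp.
Variables (R : realType) (n : nat).
Local Notation space := (Rspace R n).
Local Notation spacetime := (Rspacetime R n).
Local Notation mu := (lebesgue_spacetime R n).
Implicit Types (A a c t T r : R) (z w : spacetime).

(** The constants of the bound in [heat_kernel_ge], times the factors [2^-n] and [1 / 4] from the
    measure of a cube of side [sqrt t / 2] over a time interval of length [t / 4]. *)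
Definition cusp_const a : R :=
  2^-1 `^ a / Gamma a * ((4 * pi) `^ (n%:R / 2))^-1 * expR (- (n%:R / 2))
    * 2^-1 ^+ n / 4.

Lemma cusp_const_gt0 a : 0 < a -> 0 < cusp_const a.
Proof.
move=> a0; rewrite /cusp_const !mulr_gt0 ?expR_gt0 ?invr_gt0 ?exprn_gt0 ?Gamma_gt0//.
by rewrite powR_gt0// mulr_gt0 ?pi_gt0.
Qed.

(** Whatever the sign of [a - 1], [s^(a - 1) = s^a / s >= (t / 2)^a / t]. The normalizing factor
    decreases in [s], and [|x - y|^2 <= n * t] together with [4 * s >= 2 * t] bounds the Gaussian
    exponent by [n / 2]. *)
Lemma heat_kernel_ge a (x y : space) (s t : R) : 0 < a -> t / 2 <= s <= t -> 0 < t ->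
  (forall i, `|tnth x i - tnth y i| <= Num.sqrt t) ->
  t `^ (a - 1) * 2^-1 `^ a / Gamma a * ((4 * pi * t) `^ (n%:R / 2))^-1
    * expR (- (n%:R / 2)) <= heat_kernel a (subv x y, s).
Proof.
move=> a0 /andP[ts st] t0 xy.
have s0 : 0 < s by lra.
have pi0 : 0 < pi :> R := pi_gt0 R.
rewrite /heat_kernel /= s0.
have e1 : t `^ (a - 1) * 2^-1 `^ a <= s `^ (a - 1).
  rewrite !powRB ?(gt_eqF s0) ?(gt_eqF t0) ?implybT// !powRr1 ?(ltW s0) ?(ltW t0)//.
  rewrite mulrAC -powRM ?invr_ge0 ?(ltW t0)//.
  apply: ler_pM; rewrite ?powR_ge0 ?invr_ge0 ?(ltW t0)//.
    by apply: ge0_ler_powR; rewrite ?nnegrE ?divr_ge0 ?(ltW t0) ?(ltW s0) ?(ltW a0).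
  by rewrite lef_pV2 ?posrE.
have e2 : ((4 * pi * t) `^ (n%:R / 2))^-1 <= ((4 * pi * s) `^ (n%:R / 2))^-1.
  have p4 : 0 < 4 * pi :> R by rewrite mulr_gt0.
  rewrite lef_pV2 ?posrE ?powR_gt0 ?mulr_gt0//.
  apply: ge0_ler_powR; rewrite ?nnegrE ?divr_ge0 ?mulr_ge0 ?(ltW pi0) ?(ltW t0) ?(ltW s0)//.
  by rewrite ler_pM2l.
have e3 : expR (- (n%:R / 2)) <= expR (- (enorm (subv x y) ^+ 2 / (4 * s))).
  rewrite ler_expR lerN2 ler_pdivrMr ?mulr_gt0//.
  rewrite /enorm sqr_sqrtr; last by apply: sumr_ge0 => i _; exact: sqr_ge0.
  apply: (@le_trans _ _ (\sum_(i < n) t)).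
    apply: ler_sum => i _; rewrite tnth_mktuple -[X in _ <= X](@sqr_sqrtr _ t) ?(ltW t0)//.
    by rewrite -real_normK ?num_real// lerXn2r ?nnegrE ?sqrtr_ge0.
  rewrite (_ : n%:R / 2 * (4 * s) = n%:R * (2 * s)); last by field.
  rewrite sumr_const card_ord -[leLHS]mulr_natl.
  by apply: ler_wpM2l; [exact: ler0n|lra].
have g0 : 0 < Gamma a := Gamma_gt0 a0.
apply: ler_pM => //; rewrite ?expR_ge0//.
  by rewrite mulr_ge0 ?invr_ge0 ?powR_ge0// divr_ge0 ?mulr_ge0 ?powR_ge0 ?(ltW g0).
apply: ler_pM => //; rewrite ?invr_ge0 ?powR_ge0//.
  by rewrite divr_ge0 ?mulr_ge0 ?powR_ge0 ?(ltW g0).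
by rewrite ler_pM2r ?invr_gt0.
Qed.

(* With [t] the age of [z], i.e. [frac_part z.2], the points of age between
   [t / 4] and [t / 2] in the horn contain a cube of side [sqrt t / 2]; they
   are at parabolic distance of order [sqrt t] from [z], and there the kernel
   is at least of order [t `^ (a - 1 - n / 2)]. *)
Lemma heat_potential_cusp_ge A a c z : 0 < a -> 0 <= A -> 0 <= c -> (0 < n)%N ->
  z \in @horn R n ->
  ((cusp_const a * A * frac_part z.2 `^ (a - c))%:E <=
    heat_potential a (cusp A c) z)%E.
Proof.
move=> a0 A0 c0 n0; rewrite inE => -[z2 zx].
set t := frac_part z.2 in zx *.
(* [0 < n] supplies a coordinate strictly between 0 and [sqrt t], which rules out age 0. *)
have st0 : 0 < Num.sqrt t by have /andP[h1 h2] := zx (Ordinal n0); exact: lt_trans h2.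
have t0 : 0 < t by rewrite -sqrtr_gt0.
have t1 : t < 1 by have /andP[] := frac_part_itv z.2.
pose T : R := (Num.floor z.2)%:~R.
have zT : z.2 = T + t by rewrite /t /frac_part addrC subrK.
have nT : n.+2%:R <= T.
  by rewrite -[_%:R]/((n.+2%:Z)%:~R) ler_int floor_ge_int.
pose B := @cube R n (Num.sqrt t / 2).
(* For [w] in this time interval the lag [z.2 - w.2] lies between [t / 2] and [3 * t / 4], within
   the range of [heat_kernel_ge]. *)
pose J := `]T + t / 4, T + t / 2[%classic : set (measurableTypeR R).
have mB : measurable B by exact: measurable_cube.
have mJ : measurable J by exact: measurable_itv.
have muBJ : mu (B `*` J) = ((Num.sqrt t / 2) ^+ n * (t / 4))%:E.
  transitivity (lebesgue_tuple R n B * @lebesgue_measure R J)%E.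
    exact: product_measure1E.
  rewrite lebesgue_tuple_cube ?divr_ge0 ?sqrtr_ge0// EFinM; congr (_ * _)%E.
  rewrite lebesgue_measure_itv /= lte_fin ltrD2l ifT; last by lra.
  by rewrite -EFinD; congr EFin; lra.
pose k : R := t `^ (a - 1) * 2^-1 `^ a / Gamma a * ((4 * pi * t) `^ (n%:R / 2))^-1
    * expR (- (n%:R / 2)) * (A * t `^ (- c)).
have -> : cusp_const a * A * t `^ (a - c) = k * ((Num.sqrt t / 2) ^+ n * (t / 4)).
  have sn : t `^ (n%:R / 2) = Num.sqrt t ^+ n.
    by rewrite -powR12_sqrt ?ltW// -powR_mulrn ?powR_ge0// -powRrM mulrC.
  rewrite /k /cusp_const (@powRM _ (4 * pi) t) ?mulr_ge0 ?pi_ge0 ?(ltW t0)// sn invfM expr_div_n.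
  rewrite powRD ?(gt_eqF t0) ?implybT// -(mulr_powRB1 (ltW t0) a0).
  have g0 : Gamma a != 0 by rewrite gt_eqF// Gamma_gt0.
  have s0 : Num.sqrt t ^+ n != 0 by rewrite gt_eqF// exprn_gt0.
  have p0 : (4 * pi) `^ (n%:R / 2) != 0 :> R.
    by rewrite gt_eqF// powR_gt0// mulr_gt0 ?pi_gt0.
  have q0 : 2 ^+ n != 0 :> R by rewrite expf_neq0.
  by rewrite exprVn; field; rewrite g0 s0 p0 q0.
rewrite EFinM -muBJ.
have mBJ : measurable (B `*` J) by exact: measurableX.
have -> : (k%:E * mu (B `*` J) = \int[mu]_(w in B `*` J) k%:E)%E.
  by symmetry; exact: (integral_cst mu mBJ).
have mK : measurable_fun [set: spacetime] (fun w =>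
    (heat_kernel a (subv z.1 w.1, z.2 - w.2) * cusp A c w)%:E).
  apply/measurable_EFinP; apply: measurable_funM; last exact: measurable_cusp.
  exact: (measurable_fun_pair2 z (@measurable_heat_kernel_shift R n a)).
apply: (@le_trans _ _ (\int[mu]_(w in B `*` J)
    (heat_kernel a (subv z.1 w.1, z.2 - w.2) * cusp A c w)%:E)%E); last first.
  apply: ge0_subset_integral => //.
  - exact: (@measurable_slab R n `]-oo, z.2[%classic).
  - exact: measurable_funTS.
  - by move=> w _; rewrite lee_fin mulr_ge0 ?heat_kernel_ge0 ?cusp_ge0.
  - move=> w [_]; rewrite /J /= in_itv /= => /andP[_ h].
    by rewrite zT; apply: lt_trans h _; rewrite ltrD2l; lra.
apply: ge0_le_integral => //.
- move=> w _; rewrite lee_fin /k !mulr_ge0 ?powR_ge0 ?expR_ge0 ?invr_ge0 ?powR_ge0//.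
  by rewrite ltW// Gamma_gt0.
- exact: measurable_funTS.
move=> w [Bw]; rewrite /J /= in_itv /= => /andP[w1 w2].
have fw : frac_part w.2 = w.2 - T by apply: frac_partE; rewrite -/T; lra.
(* The age of [w] exceeds [t / 4], so the horn is there at least as wide as the cube of side
   [sqrt t / 2]. *)
have wh : w \in @horn R n.
  rewrite inE; split; first lra.
  move=> i; have := Bw i; rewrite /= in_itv /= => /andP[-> /= h].
  apply: lt_le_trans h _; rewrite fw.
  have -> : Num.sqrt t / 2 = Num.sqrt (t / 4).
    rewrite sqrtrM ?ltW//; congr (_ * _).
    by rewrite (_ : 4^-1 = 2^-1 ^+ 2) ?sqrtr_sqr ?ger0_norm//; field.
  by rewrite ler_sqrt; lra.
rewrite lee_fin; apply: ler_pM.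
- by rewrite !mulr_ge0 ?powR_ge0 ?expR_ge0 ?invr_ge0 ?powR_ge0// ltW// Gamma_gt0.
- by rewrite mulr_ge0 ?powR_ge0.
- apply: heat_kernel_ge => //; first by rewrite zT; lra.
  move=> i; have := Bw i; rewrite /= in_itv /= => /andP[h1 h2].
  have /andP[h3 h4] := zx i.
  by rewrite ler_norml; lra.
(* The age of [w] is below [t] and [c >= 0], so the profile at [w] is at least its value at age
   [t]. *)
- rewrite /cusp wh fw ler_wpM2l// !powRN lef_pV2 ?posrE ?powR_gt0//; last lra.
  by apply: ge0_ler_powR; rewrite ?nnegrE//; lra.
Qed.

End potential_of_cusp.

(** * From divergence at one exponent to infinite norms at all larger ones *)

Section infinite_norm.
Variables (R : realType) (n : nat).
Local Notation spacetime := (Rspacetime R n).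
Local Notation mu := (lebesgue_spacetime R n).

(** As [B] has finite measure, divergence at [r0] passes to larger exponents: [F^r0 <= 1 + F^r] for
    finite [r >= r0], while an essential bound [b] would make the integral of [F^r0] over [B] at
    most [b^r0 * mu B]. *)
Lemma Lnorm_on_pinfty (D B : set spacetime) (F : spacetime -> R) (r0 : R) (r : \bar R) :
  measurable D -> measurable B -> B `<=` D -> (mu B < +oo)%E ->
  measurable_fun [set: spacetime] F -> (forall z, 0 <= F z) -> 0 < r0 ->
  (\int[mu]_(z in B) (F z `^ r0)%:E = +oo)%E -> (r0%:E <= r)%E ->
  Lnorm_on D r F = +oo%E.
Proof.
move=> mD mB BD Boo mF F0 r00 FB r0r.
have mFr (s : R) : measurable_fun [set: spacetime] (fun z => (F z `^ s)%:E).
  by apply/measurable_EFinP; apply: (measurableT_comp (measurable_powR _)).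
have Fs0 (s : R) z : (0 <= (F z `^ s)%:E)%E by rewrite lee_fin powR_ge0.
have restrE z : 0 <= (F \_ D) z by rewrite patchE; case: ifP.
have B0 : (0 < mu B)%E.
  rewrite lt_neqAle measure_ge0 andbT eq_sym; apply/eqP => B0; move: FB.
  rewrite (_ : (\int[_]_(z in B) _)%E = 0%E) //.
  apply: null_set_integral => //; first exact: measurable_funTS.
rewrite /Lnorm_on unlock; case: r r0r => [r||] //; last first.
(* The conditional in the norm at infinity asks for a space of positive measure; [B0] provides
   it. *)
- move=> _ /=; rewrite ifT; last first.
    by apply: (lt_le_trans B0); apply: le_measure; rewrite ?inE.
  apply/eqP; rewrite -leye_eq leNgt; apply/negP => fin.
  set M := ess_sup _ _ in fin.
  have aeM : \forall z \ae mu, (`| (F \_ D) z |%:E <= M)%E by exact: ess_sup_ge.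
  (* The maximum with 0 yields a nonnegative bound, as the monotonicity of powers requires. *)
  have [b Mb] : exists b : R, 0 <= b /\ (M <= b%:E)%E.
    exists (Num.max 0 (fine M)); split; first by rewrite le_max lexx.
    case: M fin {aeM} => [m||]//= _; last by rewrite leNye.
    by rewrite lee_fin le_max lexx orbT.
  have : (\int[mu]_(z in B) (F z `^ r0)%:E <= \int[mu]_(z in B) (b `^ r0)%:E)%E.
    apply: ae_ge0_le_integral => //.
    - exact: measurable_funTS.
    - by move=> z _; rewrite lee_fin powR_ge0.
    case: aeM => N [mN N0 sN]; exists N; split => // z /= nz; apply: sN => /= h.
    apply: nz => Bz; have := le_trans h Mb.2.
    rewrite lee_fin patchE mem_set ?ger0_norm//; last exact: BD.
    move=> Fb; rewrite lee_fin ge0_ler_powR ?nnegrE ?(ltW r00)//; exact: Mb.1.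
  rewrite FB leye_eq => /eqP.
  rewrite integral_cst// => h.
  have : ((b `^ r0)%:E * mu B < +oo)%E.
    by apply: lte_mul_pinfty; rewrite ?lee_fin ?powR_ge0.
  by rewrite h ltxx.
rewrite lee_fin => r0r /=.
have r_gt0 : 0 < r by exact: lt_le_trans r0r.
have -> : (\int[mu]_x (`|((F \_ D) x)%:E| `^ r) = \int[mu]_(x in D) (F x `^ r)%:E)%E.
  rewrite [RHS]integral_mkcond; apply: eq_integral => z _.
  rewrite !patchE; case: ifP => _ /=; first by rewrite ger0_norm.
  by rewrite normr0 powR0// gt_eqF.
suff -> : (\int[mu]_(x in D) (F x `^ r)%:E = +oo)%E.
  by rewrite poweRyr // gt_eqF ?invr_gt0.
apply/eqP; rewrite -leye_eq.
apply: (@le_trans _ _ (\int[mu]_(x in B) (F x `^ r)%:E)%E); last first.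
  by apply: ge0_subset_integral => //; exact: measurable_funTS.
have : (\int[mu]_(z in B) (F z `^ r0)%:E <=
    \int[mu]_(z in B) ((cst 1) z + (F z `^ r)%:E))%E.
  apply: ge0_le_integral => //.
  - exact: measurable_funTS.
  - apply: emeasurable_funD => //; exact: measurable_funTS.
  move=> z _; rewrite -EFinD lee_fin.
  have [F1|F1] := leP (F z) 1.
    apply: (@le_trans _ _ 1); last by rewrite lerDl powR_ge0.
    have p1 : 1 `^ r0 = 1 :> R by rewrite powR1.
    rewrite -[leRHS]p1; apply: ge0_ler_powR; rewrite ?nnegrE ?(ltW r00)//.
  apply: (@le_trans _ _ (F z `^ r)); last by rewrite lerDr.
  by apply: ler_powR => //; exact: ltW.
rewrite FB ge0_integralD//; last exact: measurable_funTS.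
rewrite integral_cst// mul1e => h; rewrite leNgt; apply/negP => h2.
by have := lte_add_pinfty Boo h2; rewrite ltNge h.
Qed.

End infinite_norm.

(** * Profiles below powers of potentials, and norms on the cylinders *)

Section comparison.
Variables (R : realType) (n : nat).
Local Notation spacetime := (Rspacetime R n).
Local Notation mu := (lebesgue_spacetime R n).

(** On the horn this is [heat_potential_cusp_ge] raised to the power [s]; elsewhere the left side is
    0. Finiteness is assumed because [fine] sends an infinite potential to 0, which would lose the
    lower bound. *)
Lemma cusp_le_powR (a c A s : R) z : (0 < n)%N ->
  0 < a -> 0 <= c -> 0 <= A -> 0 < s ->
  heat_potential a (@cusp R n A c) z \is a fin_num ->
  cusp ((cusp_const n a * A) `^ s) ((c - a) * s) z <=
    fine (heat_potential a (cusp A c) z) `^ s.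
Proof.
move=> n0 a0 c0 A0 s0 Jfin; rewrite /cusp -/(cusp _ _).
case: ifPn => zh; last exact: powR_ge0.
have k0 : 0 <= cusp_const n a * A by rewrite mulr_ge0// ltW// cusp_const_gt0.
rewrite -mulNr opprB powRrM -powRM ?powR_ge0//.
have le : cusp_const n a * A * frac_part z.2 `^ (a - c) <= fine (heat_potential a (cusp A c) z).
  by rewrite -lee_fin fineK//; exact: heat_potential_cusp_ge.
have kt : 0 <= cusp_const n a * A * frac_part z.2 `^ (a - c).
  by apply: mulr_ge0 => //; exact: powR_ge0.
by apply: ge0_ler_powR; rewrite ?nnegrE ?(ltW s0)//; exact: le_trans le.
Qed.

Lemma measurable_parabolic_cylinder (t : R) : measurable (@parabolic_cylinder R n t).
Proof.
rewrite (_ : parabolic_cylinder t = [set z | `]t, 2 * t[%classic z.2] `&`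
   ((@enorm R n \o fst) @^-1` `]-oo, Num.sqrt t[%classic)).
  apply: measurableI; first exact: measurable_slab.
  rewrite -[X in measurable X]setTI.
  by apply: (measurableT_comp (@measurable_enorm R n)) => //; exact: measurable_fst.
by apply/seteqP; split => z; rewrite /parabolic_cylinder /= !in_itv /= => -[].
Qed.

(** The test set is the piece of the horn between the times [k] and [k + 1]. As [c * r0] is
    critical, already the power [r0] of [cusp A c] has infinite integral there. *)
Lemma Lnorm_on_parabolic_cylinder (A c r0 : R) (r : \bar R) (F : spacetime -> R) (k : nat) :
  0 < A -> 0 < r0 -> c * r0 = (n%:R + 2) / 2 -> (n.+2 <= k)%N ->
  measurable_fun [set: spacetime] F -> (forall z, 0 <= F z) ->
  {ae mu, forall z, cusp A c z <= F z} -> (r0%:E <= r)%E ->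
  Lnorm_on (parabolic_cylinder k%:R) r F = +oo%E.
Proof.
move=> A0 r00 cr nk mF F0 cF r0r.
pose S := [set z : spacetime | (k%:R < z.2 < k.+1%:R)%R].
have mS : measurable S.
  rewrite (_ : S = [set z | `]k%:R, k.+1%:R[%classic z.2]); first exact: measurable_slab.
  by apply/seteqP; split => z /=; rewrite in_itv.
have mB : measurable (S `&` @horn R n) by apply: measurableI => //; exact: measurable_horn.
(* The slab [S] has infinite measure as soon as [n > 0]; its part in the horn has finite measure and
   carries the whole integral. *)
have Soff A' c' : 0 <= A' -> (\int[mu]_(z in S `&` @horn R n) (cusp A' c' z)%:E =
    \int[mu]_(z in S) (cusp A' c' z)%:E)%E.
  move=> A'0; rewrite [LHS]integral_mkcond [RHS]integral_mkcond.
  apply: eq_integral => z _; rewrite !patchE in_setI.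
  by case: (z \in S) => //=; case: ifPn => // zh; rewrite /cusp (negbTE zh).
apply: (@Lnorm_on_pinfty R n _ (S `&` @horn R n) F r0) => //.
- exact: measurable_parabolic_cylinder.
- move=> z [/= /andP[kz zk] [_ zh]]; split; last first.
    rewrite kz /=; apply: lt_le_trans zk _.
    by rewrite -natrM ler_nat mul2n -addnn -addn1 leq_add2l; exact: leq_trans nk.
  rewrite /enorm ltr_sqrt ?ltr0n; last exact: leq_trans nk.
  apply: (@le_lt_trans _ _ (\sum_(i < n) (1 : R))).
    apply: ler_sum => i _; have /andP[h1 h2] := zh i.
    rewrite exprn_ile1 ?ltW//; apply: lt_le_trans h2 _.
    rewrite -sqrtr1 ler_sqrt//; have /andP[_ /ltW//] := frac_part_itv z.2.
  by rewrite sumr_const card_ord ltr_nat; exact: leq_trans nk.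
(* [cusp 1 0] is the indicator of the horn, so this measure is an integral covered by
   [integral_cusp_lty]. *)
- have -> : mu (S `&` @horn R n) = (\int[mu]_(z in S `&` @horn R n) (cusp 1 0 z)%:E)%E.
    rewrite -[LHS]mul1e -integral_cst//; apply: eq_integral => z; rewrite in_setI.
    by move=> /andP[_ zh]; rewrite /cusp zh oppr0 powRr0 mulr1.
  have l : (0 : R) < (n%:R + 2) / 2 by rewrite divr_gt0// ltr_wpDl.
  apply: le_lt_trans (@integral_cusp_lty R n 1 0 k.+1%:R ler01 l).
  apply: ge0_subset_integral => //.
  + by rewrite (_ : mkset _ = [set z | `]-oo, k.+1%:R[%classic z.2]);
      [exact: measurable_slab|apply/seteqP; split => z /=; rewrite in_itv].
  + by apply: measurable_funTS; apply/measurable_EFinP; exact: measurable_cusp.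
  + by move=> z _; rewrite lee_fin cusp_ge0.
  + by move=> z [/= /andP[]].
- apply/eqP; rewrite -leye_eq.
  rewrite -(@integral_cusp_pinfty R n (A `^ r0) k (powR_gt0 _ A0) nk) -Soff ?powR_ge0//.
  apply: ae_ge0_le_integral => //.
  + by move=> z _; rewrite lee_fin cusp_ge0 ?powR_ge0.
  + by apply: measurable_funTS; apply/measurable_EFinP; exact: measurable_cusp.
  + by move=> z _; rewrite lee_fin powR_ge0.
  + apply: measurable_funTS; apply/measurable_EFinP.
    exact: (measurableT_comp (measurable_powR _)).
  case: cF => N [mN N0 sN]; exists N; split => // z /= nz; apply: sN => /= h.
  apply: nz => _; rewrite lee_fin -cr -cusp_powR ?(ltW A0) ?gt_eqF//.
  by apply: ge0_ler_powR; rewrite ?nnegrE ?(ltW r00) ?cusp_ge0 ?(ltW A0).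
Qed.

End comparison.

(** * Arithmetic of the exponents *)

Section exponents.
Variable R : realType.

(** In the normalization of [exponent_v_gt], the two inequalities assumed last say [p < r0] and
    [hcompare], and the conclusion says [q < s0]. Denying it forces
    [(1 - a) * X <= 1 < (1 - b) * Y]. *)
Lemma dual_exponent (X Y a b : R) : 0 < X -> 0 < Y -> 0 < a -> 0 < b -> a < 1 ->
  1 + Y * b < X * Y * (1 - a) -> (1 - a) * X <= (1 - b) * Y ->
  1 + X * a < X * Y * (1 - b).
Proof.
move=> X0 Y0 a0 b0 a1 H1 H2; rewrite ltNge; apply/negP => H3.
have aX : 0 < (1 - a) * X by rewrite mulr_gt0// subr_gt0.
have bY : 0 < (1 - b) * Y by exact: lt_le_trans H2.
(* Multiplied by [Y], resp. [X], the second hypothesis becomes a quadratic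
   inequality for which [-1] is a root of the polynomial. *)
have HY : (1 - a) * X * Y <= (1 - b) * Y * Y by rewrite ler_pM2r.
have HX : (1 - a) * X * X <= (1 - b) * Y * X by rewrite ler_pM2r.
have Y1 : 1 < (1 - b) * Y.
  have : 0 < (Y + 1) * ((1 - b) * Y - 1) by lra.
  by rewrite pmulr_rgt0 ?subr_gt0// addr_gt0.
have X1 : (1 - a) * X <= 1.
  have : (X + 1) * ((1 - a) * X - 1) <= 0 by lra.
  by rewrite pmulr_rle0 ?subr_le0// addr_gt0.
(* [l1] and [l2] add up to [X * Y * (a - b) - a * X + b * Y > 0], while [H1] and [H3] add up to the
   opposite strict inequality. *)
have l1 : 0 < a * X * ((1 - b) * Y - 1) by rewrite !mulr_gt0// subr_gt0.
have l2 : 0 <= b * Y * (1 - (1 - a) * X) by rewrite !mulr_ge0 ?(ltW b0) ?(ltW Y0) ?subr_ge0.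
lra.
Qed.

Variables (N p q lambda sigma alpha beta : R).
Hypotheses (N0 : 0 < N) (p0 : 0 < p) (q0 : 0 < q) (l0 : 0 < lambda) (s0 : 0 < sigma)
  (a0 : 0 < alpha) (b0 : 0 < beta).
Hypothesis hcompare :
  (N - 2 * p * alpha) * q ^+ 2 * sigma <= (N - 2 * q * beta) * p ^+ 2 * lambda.
Hypothesis hsub : 2 * p * alpha < N.
Hypothesis hmu :
  2 * p * beta / (N - 2 * p * alpha) + N / ((N - 2 * p * alpha) * lambda) < sigma.

Let hmu' : 2 * p * beta * lambda + N < sigma * (N - 2 * p * alpha) * lambda.
Proof.
have K0 : 0 < N - 2 * p * alpha by rewrite subr_gt0.
have Kl : 0 < (N - 2 * p * alpha) * lambda by rewrite mulr_gt0.
move: hmu; rewrite -(ltr_pM2r Kl).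
rewrite (_ : (_ + _) * _ = 2 * p * beta * lambda + N) ?mulrA//.
by field; rewrite !gt_eqF.
Qed.

(** [hmu'] bounds [N * (lambda * sigma - 1)] from below by a sum of positive terms. *)
Lemma exponent_product_gt1 : 0 < lambda * sigma - 1.
Proof.
have l1 : 0 < p * beta * lambda by rewrite !mulr_gt0.
have l2 : 0 < p * alpha * sigma * lambda by rewrite !mulr_gt0.
have := hmu'; rewrite -(pmulr_rgt0 _ N0); lra.
Qed.

(** Cleared of its denominator, the claim is exactly [hmu']. *)
Lemma exponent_u_gt : p < N * (lambda * sigma - 1) / (2 * (beta + alpha * sigma) * lambda).
Proof.
have D0 : 0 < 2 * (beta + alpha * sigma) * lambda.
  by rewrite !mulr_gt0// addr_gt0 ?mulr_gt0.
have := hmu'; rewrite ltr_pdivlMr//; lra.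
Qed.

(** The lower bound on [sigma] speaks of [r0] only. Scaling [sigma] by [q / p] and [lambda] by
    [p / q] makes the two equations symmetric, and [hcompare] then transfers the bound to [s0]
    through [dual_exponent]. *)
Lemma exponent_v_gt : q < N * (lambda * sigma - 1) / (2 * (alpha + beta * lambda) * sigma).
Proof.
have D0 : 0 < 2 * (alpha + beta * lambda) * sigma.
  by rewrite !mulr_gt0// addr_gt0 ?mulr_gt0.
have H := @dual_exponent (sigma * q / p) (lambda * p / q) (2 * p * alpha / N)
  (2 * q * beta / N).
have nz : [/\ N != 0, p != 0 & q != 0] by rewrite !gt_eqF.
case: nz => nN np nq.
have H1 : 1 + lambda * p / q * (2 * q * beta / N) <
    sigma * q / p * (lambda * p / q) * (1 - 2 * p * alpha / N).
  rewrite -(ltr_pM2l N0).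
  rewrite (_ : N * (1 + lambda * p / q * (2 * q * beta / N)) =
    2 * p * beta * lambda + N); last by field; rewrite nN nq.
  rewrite (_ : N * (sigma * q / p * (lambda * p / q) * (1 - 2 * p * alpha / N)) =
    sigma * (N - 2 * p * alpha) * lambda); last by field; rewrite nN np nq.
  exact: hmu'.
have H2 : (1 - 2 * p * alpha / N) * (sigma * q / p) <=
    (1 - 2 * q * beta / N) * (lambda * p / q).
  have Npq : 0 < N * (p * q) by rewrite !mulr_gt0.
  rewrite -(ler_pM2l Npq).
  rewrite (_ : N * (p * q) * ((1 - 2 * p * alpha / N) * (sigma * q / p)) =
    (N - 2 * p * alpha) * q ^+ 2 * sigma); last by field; rewrite nN np.
  rewrite (_ : N * (p * q) * ((1 - 2 * q * beta / N) * (lambda * p / q)) =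
    (N - 2 * q * beta) * p ^+ 2 * lambda); last by field; rewrite nN nq.
  exact: hcompare.
have : 1 + sigma * q / p * (2 * p * alpha / N) <
    sigma * q / p * (lambda * p / q) * (1 - 2 * q * beta / N).
  by apply: H => //; rewrite ?divr_gt0 ?mulr_gt0// ltr_pdivrMr ?mul1r.
rewrite -(ltr_pM2l N0).
rewrite (_ : N * (1 + sigma * q / p * (2 * p * alpha / N)) =
  N + 2 * sigma * q * alpha); last by field; rewrite nN np.
rewrite (_ : N * (sigma * q / p * (lambda * p / q) * (1 - 2 * q * beta / N)) =
  sigma * lambda * (N - 2 * q * beta)); last by field; rewrite nN np nq.
move=> H3; rewrite ltr_pdivlMr//.
(* Both sides of the goal differ from those of [H3] by the same term. *)
have -> : N * (lambda * sigma - 1) = sigma * lambda * (N - 2 * q * beta) +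
  (2 * q * beta * lambda * sigma - N) by ring.
have -> : q * (2 * (alpha + beta * lambda) * sigma) = N + 2 * sigma * q * alpha +
  (2 * q * beta * lambda * sigma - N) by ring.
by rewrite ltrD2r.
Qed.

End exponents.

(** * A subcritical profile with its potential as one component of the solution *)

Section cusp_potential.
Variables (R : realType) (n : nat).
Local Notation spacetime := (Rspacetime R n).
Local Notation mu := (lebesgue_spacetime R n).
Variables (p alpha A a : R).
Hypotheses (n0 : (0 < n)%N) (p1 : 1 <= p) (al0 : 0 < alpha) (A0 : 0 <= A) (a0 : 0 < a).
Hypothesis pa : a * p < (n%:R + 2) / 2.

Local Notation f := (@cusp R n A a).
Let u (z : spacetime) := fine (heat_potential alpha f z).

Let f_L1 (T : R) : (\int[mu]_(z in [set z : spacetime | (z.2 < T)%R]) (f z)%:E < +oo)%E.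
Proof.
(* As [p >= 1], the exponent [a <= a * p] is subcritical too. *)
by apply: integral_cusp_lty => //; apply: le_lt_trans pa; rewrite ler_peMr// ltW.
Qed.

Lemma frac_heat_cusp : frac_heat p alpha u f.
Proof.
apply: frac_heat_heat_potential => //.
- exact: measurable_cusp.
- by move=> z; exact: cusp_ge0.
- by move=> z; exact: cusp_past.
- exact: Xspace_cusp.
Qed.

(** [B] and [b] enter through equations so that the same statement serves both inequalities of the
    coupled system, where the amplitudes come from a fixed point and the exponents from a linear
    system. *)
Lemma cusp_le_potential_powR (B b s : R) : 0 < s ->
  B = (cusp_const n alpha * A) `^ s -> b = (a - alpha) * s ->
  {ae mu, forall z, @cusp R n B b z <= u z `^ s}.
Proof.
move=> s0 -> ->.
have [|z|z|N [mN N0 sN]] := @heat_potential_fin_num R n alpha f al0 _ _ _ f_L1.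
- exact: measurable_cusp.
- exact: cusp_ge0.
- exact: cusp_past.
exists N; split => // z /= nz; apply: sN => /= fz; apply: nz.
by apply: cusp_le_powR => //; exact: ltW.
Qed.

Lemma cusp_potential_past z : z.2 < 0 -> u z = 0.
Proof.
by move=> z0; rewrite /u heat_potential_past//; move=> w; exact: cusp_past.
Qed.

Lemma measurable_cusp_potential : measurable_fun [set: spacetime] u.
Proof.
apply: measurable_fine_heat_potential => //; first exact: measurable_cusp.
by move=> z; exact: cusp_ge0.
Qed.

End cusp_potential.

(* The amplitudes have to satisfy [B = (c0 A)^sigma] and [A = (c1 B)^lambda];
   since [lambda * sigma <> 1], this fixes [A]. *)
Lemma amplitude_fixpoint (R : realType) (c0 c1 lambda sigma : R) :
  0 < c0 -> 0 < c1 -> 0 < lambda * sigma - 1 ->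
  exists2 A : R, 0 < A & A = (c1 * (c0 * A) `^ sigma) `^ lambda.
Proof.
move=> c00 c10 d0.
pose E := c1 `^ lambda * c0 `^ (sigma * lambda).
have E0 : 0 < E by rewrite mulr_gt0 ?powR_gt0.
exists (E `^ (- (lambda * sigma - 1)^-1)); first exact: powR_gt0.
set A := E `^ _.
have A0 : 0 <= A by exact: powR_ge0.
rewrite powRM ?powR_ge0 ?(ltW c10)// -powRrM powRM ?(ltW c00)// mulrA -/E.
rewrite -[X in X * _](powRr1 (ltW E0)) /A -powRrM -powRD; last first.
  by rewrite (gt_eqF E0) implybT.
by congr (_ `^ _); field; rewrite gt_eqF.
Qed.

(** * Assembly of the two components *)

Theorem theorem2p6 (R : realType) (n : nat) (p q lambda sigma alpha beta : R)
    (hn : (1 <= n)%N) (hp : 1 <= p) (hq : 1 <= q)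
    (hlambda : 0 < lambda) (hsigma : 0 < sigma)
    (halpha : 0 < alpha) (hbeta : 0 < beta)
    (hpalpha :
      (1 < p /\ 0 < alpha < (n%:R + 2) / (2 * p)) \/
      (p = 1 /\ 0 < alpha <= (n%:R + 2) / (2 * p)))
    (hqbeta :
      (1 < q /\ 0 < beta < (n%:R + 2) / (2 * q)) \/
      (q = 1 /\ 0 < beta <= (n%:R + 2) / (2 * q)))
    (hcompare :
      (n%:R + 2 - 2 * p * alpha) * q ^+ 2 * sigma <=
      (n%:R + 2 - 2 * q * beta) * p ^+ 2 * lambda)
    (hsub : 2 * p * alpha < n%:R + 2)
    (hmu :
      2 * p * beta / (n%:R + 2 - 2 * p * alpha) +
        (n%:R + 2) / ((n%:R + 2 - 2 * p * alpha) * lambda) < sigma) :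
  let r0 := (n%:R + 2) * (lambda * sigma - 1) /
            (2 * (beta + alpha * sigma) * lambda) in
  let s0 := (n%:R + 2) * (lambda * sigma - 1) /
            (2 * (alpha + beta * lambda) * sigma) in
  [/\ p < r0, q < s0 &
    forall r s : \bar R, (r0%:E <= r)%E -> (s0%:E <= s)%E ->
    exists (u v Hu Hv : Rspacetime R n -> R) (t : nat -> R),
      [/\ [/\ Yspace p alpha u, Yspace q beta v,
              frac_heat p alpha u Hu & frac_heat q beta v Hv],
          {ae lebesgue_spacetime R n, forall z, 0 <= Hu z <= v z `^ lambda},
          {ae lebesgue_spacetime R n, forall z, 0 <= Hv z <= u z `^ sigma},
          {ae lebesgue_spacetime R n, forall z : Rspacetime R n,
             z.2 < 0 -> u z = 0 /\ v z = 0} &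
          [/\ forall j, 1 < t j, t @ \oo --> +oo &
            forall j,
            [/\ Lnorm_on (parabolic_cylinder (t j)) r (fun z => v z `^ lambda)
                  = +oo%E,
                Lnorm_on (parabolic_cylinder (t j)) r Hu = +oo%E,
                Lnorm_on (parabolic_cylinder (t j)) s (fun z => u z `^ sigma)
                  = +oo%E &
                Lnorm_on (parabolic_cylinder (t j)) s Hv = +oo%E]]]].
Proof.
set r0 := _ / _; set s0 := _ / _ => /=.
have N0 : 0 < n%:R + 2 :> R by rewrite ltr_wpDl.
have p0 : 0 < p by exact: lt_le_trans hp.
have q0 : 0 < q by exact: lt_le_trans hq.
have pr0 : p < r0 by exact: exponent_u_gt.
have qs0 : q < s0 by exact: (exponent_v_gt (p := p)).
have d0 : 0 < lambda * sigma - 1.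
  exact: (exponent_product_gt1 N0 p0 hlambda hsigma halpha hbeta hsub hmu).
have D0 : 0 < beta + alpha * sigma by rewrite addr_gt0 ?mulr_gt0.
have D1 : 0 < alpha + beta * lambda by rewrite addr_gt0 ?mulr_gt0.
split => // r s r0r s0s.
(* The solution of the linear system recorded in [ab] and [ba]; [ar0] and [bs0] identify [r0] and
   [s0] as the critical exponents of the two profiles. *)
pose a := lambda * (beta + alpha * sigma) / (lambda * sigma - 1).
pose b := sigma * (alpha + beta * lambda) / (lambda * sigma - 1).
have a0 : 0 < a by rewrite divr_gt0 ?mulr_gt0.
have b0 : 0 < b by rewrite divr_gt0 ?mulr_gt0.
have nz : [/\ lambda * sigma - 1 != 0, beta + alpha * sigma != 0,
  alpha + beta * lambda != 0, lambda != 0 & sigma != 0] by rewrite !gt_eqF.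
case: nz => nd nD0 nD1 nl ns.
have ar0 : a * r0 = (n%:R + 2) / 2 by rewrite /a /r0; field; rewrite nd nD0 nl.
have bs0 : b * s0 = (n%:R + 2) / 2 by rewrite /b /s0; field; rewrite nd nD1 ns.
have ab : a = (b - beta) * lambda by rewrite /a /b; field; rewrite nd.
have ba : b = (a - alpha) * sigma by rewrite /a /b; field; rewrite nd.
have ap : a * p < (n%:R + 2) / 2 by rewrite -ar0 ltr_pM2l.
have bq : b * q < (n%:R + 2) / 2 by rewrite -bs0 ltr_pM2l.
have [A A0 fixA] := amplitude_fixpoint (cusp_const_gt0 n halpha) (cusp_const_gt0 n hbeta) d0.
pose B := (cusp_const n alpha * A) `^ sigma.
have B0 : 0 < B by rewrite powR_gt0// mulr_gt0 ?cusp_const_gt0.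
pose f := @cusp R n A a; pose g := @cusp R n B b.
pose u z := fine (heat_potential alpha f z).
pose v z := fine (heat_potential beta g z).
have fv : {ae lebesgue_spacetime R n, forall z, f z <= v z `^ lambda}.
  exact: (cusp_le_potential_powR hn hq hbeta (ltW B0) b0 bq hlambda).
have gu : {ae lebesgue_spacetime R n, forall z, g z <= u z `^ sigma}.
  exact: (cusp_le_potential_powR hn hp halpha (ltW A0) a0 ap hsigma).
have fu := frac_heat_cusp hp halpha (ltW A0) a0 ap.
have gv := frac_heat_cusp hq hbeta (ltW B0) b0 bq.
have mu' : measurable_fun setT u by apply: measurable_cusp_potential => //; exact: ltW.
have mv' : measurable_fun setT v by apply: measurable_cusp_potential => //; exact: ltW.
have r00 : 0 < r0 by exact: lt_trans pr0.
have s00 : 0 < s0 by exact: lt_trans qs0.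
(* None of these depends on [r] or [s]. The times are the integers from [n.+2] on, at which the
   horns start. *)
exists u, v, f, g, (fun j => (j + n.+2)%:R); split.
- by split; [case: fu|case: gv|exact: fu|exact: gv].
- case: fv => N [mN nN sN]; exists N; split => // z /= nz; apply: sN => /= h.
  by apply: nz; rewrite cusp_ge0 ?(ltW A0).
- case: gu => N [mN nN sN]; exists N; split => // z /= nz; apply: sN => /= h.
  by apply: nz; rewrite cusp_ge0 ?(ltW B0).
- by apply: aeW => z z0; split; exact: cusp_potential_past.
have le k : (n.+2 <= k + n.+2)%N by rewrite leq_addl.
split.
- by move=> j; rewrite ltr1n addnS ltnS addnS.
- apply/cvgryPge => M; exists (Num.truncn M).+1 => //= j /= Mj.
  by apply: le_trans (ltW (truncnS_gt _)) _; rewrite ler_nat (leq_trans Mj)// leq_addr.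
have f0 z : 0 <= f z by rewrite cusp_ge0// ltW.
have g0 z : 0 <= g z by rewrite cusp_ge0// ltW.
have powm (w : Rspacetime R n -> R) (e : R) : measurable_fun setT w ->
    measurable_fun setT (fun z => w z `^ e).
  by move=> mw; exact: (measurableT_comp (measurable_powR _)).
move=> j; split.
- apply: (Lnorm_on_parabolic_cylinder A0 r00 ar0 (le j) _ _ fv r0r).
    exact: powm.
  by move=> z; exact: powR_ge0.
- apply: (Lnorm_on_parabolic_cylinder A0 r00 ar0 (le j) _ f0 _ r0r).
    exact: measurable_cusp.
  by apply: aeW => z; exact: lexx.
- apply: (Lnorm_on_parabolic_cylinder B0 s00 bs0 (le j) _ _ gu s0s).
    exact: powm.
  by move=> z; exact: powR_ge0.
- apply: (Lnorm_on_parabolic_cylinder B0 s00 bs0 (le j) _ g0 _ s0s).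
    exact: measurable_cusp.
  by apply: aeW => z; exact: lexx.
Qed.
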